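(* Let $f\in \mathrm{Diff}^1_+([0,1])$ be a diffeomorphism without hyperbolic fixed points, let $x_0\in[0,1]$ with $f(x_0)\neq x_0$, and let $G\subset \mathrm{Diff}^1_+([0,1])$ be a group whose elements are all supported in the fundamental domain $J$ of $f$ with endpoints $x_0$ and $f(x_0)$. Assume there is a path $(h_t)_{t\in[0,1)}$ in $\mathrm{Diff}^1_+([0,1])$, continuous for the $C^1$-topology, such that every $h_t$ is supported in $J$ and $h_t g h_t^{-1}\to\mathrm{id}$ in the $C^1$-topology as $t\to1$ for every $g\in G$. Then there is a $C^1$-continuous path $(H_t)_{t\in[0,1)}$ in $\mathrm{Diff}^1_+([0,1])$ such that each $H_t$ is supported in the support of $f$, $DH_t(0)=DH_t(1)=1$, and $H_t g H_t^{-1}\to\mathrm{id}$ in the $C^1$-topology as $t\to 1$ for every $g$ in the group $\langle f,G\rangle$ generated by $f$ and $G$. In particular $\langle f,G\rangle$ is $C^1$-close to the identity.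
   Context: A diffeomorphism $f$ is without hyperbolic fixed points if $Df(x)=1$ for every fixed point $x$ of $f$. The support of a homeomorphism is the closure of the set of non-fixed points. A group $G\subset \mathrm{Diff}^1_+([0,1])$ is $C^1$-close to the identity if there is a sequence $h_n\in \mathrm{Diff}^1_+([0,1])$ such that $h_n g h_n^{-1}\to \mathrm{id}$ in the $C^1$-topology for every $g\in G$. *)

(* Defs.v *)
From Stdlib Require Import Reals Lra.
Open Scope R_scope.

(* Elements of Diff^1_+([0,1]) are represented by functions R -> R; only
   their values on [0,1] matter. *)
Definition I01 (x : R) : Prop := 0 <= x <= 1.

Definition is_deriv01 (f d : R -> R) : Prop :=
  forall x, I01 x -> forall eps, 0 < eps -> exists delta, 0 < delta /\
    forall y, I01 y -> y <> x -> Rabs (y - x) < delta ->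
      Rabs ((f y - f x) / (y - x) - d x) < eps.

Definition cont01 (d : R -> R) : Prop :=
  forall x, I01 x -> forall eps, 0 < eps -> exists delta, 0 < delta /\
    forall y, I01 y -> Rabs (y - x) < delta -> Rabs (d y - d x) < eps.

Definition Diff1p (f : R -> R) : Prop :=
  (forall x, I01 x -> I01 (f x)) /\ f 0 = 0 /\ f 1 = 1 /\
  (forall x y, I01 x -> I01 y -> x < y -> f x < f y) /\
  exists d, is_deriv01 f d /\ cont01 d /\ (forall x, I01 x -> 0 < d x).

Definition is_inv01 (f g : R -> R) : Prop :=
  forall x, I01 x -> I01 (g x) /\ f (g x) = x /\ g (f x) = x.

Definition no_hyp_fixed (f : R -> R) : Prop :=
  forall x, I01 x -> f x = x -> forall d, is_deriv01 f d -> d x = 1.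

Definition support (h : R -> R) (x : R) : Prop :=
  I01 x /\ forall eps, 0 < eps -> exists y, I01 y /\ Rabs (y - x) < eps /\ h y <> y.

Definition supported_in (h : R -> R) (S : R -> Prop) : Prop :=
  forall x, support h x -> S x.

Definition segment (a b : R) (x : R) : Prop := Rmin a b <= x <= Rmax a b.

Definition is_group (G : (R -> R) -> Prop) : Prop :=
  (forall g, G g -> Diff1p g) /\ G (fun x => x) /\
  (forall a b, G a -> G b -> G (fun x => a (b x))) /\
  (forall a, G a -> exists b, G b /\ is_inv01 a b).

Inductive gen_group (f : R -> R) (G : (R -> R) -> Prop) : (R -> R) -> Prop :=
| gen_f : gen_group f G f
| gen_G : forall g, G g -> gen_group f G g
| gen_comp : forall a b, gen_group f G a -> gen_group f G b ->
    gen_group f G (fun x => a (b x))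
| gen_inv : forall a b, gen_group f G a -> is_inv01 a b -> gen_group f G b.

Definition C1_to_id_at1 (k : R -> R -> R) : Prop :=
  forall eps, 0 < eps -> exists delta, 0 < delta /\
    forall t, 1 - delta < t < 1 -> forall x, I01 x ->
      Rabs (k t x - x) < eps /\
      forall d, is_deriv01 (k t) d -> Rabs (d x - 1) < eps.

Definition C1_seq_to_id (k : nat -> R -> R) : Prop :=
  forall eps, 0 < eps -> exists N, forall n, (N <= n)%nat -> forall x, I01 x ->
    Rabs (k n x - x) < eps /\
    forall d, is_deriv01 (k n) d -> Rabs (d x - 1) < eps.

Definition C1_path (h : R -> R -> R) : Prop :=
  forall t0, 0 <= t0 < 1 -> forall eps, 0 < eps -> exists delta, 0 < delta /\
    forall t, 0 <= t < 1 -> Rabs (t - t0) < delta -> forall x, I01 x ->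
      Rabs (h t x - h t0 x) < eps /\
      forall d d0, is_deriv01 (h t) d -> is_deriv01 (h t0) d0 ->
        Rabs (d x - d0 x) < eps.

Definition C1_close_to_id (G : (R -> R) -> Prop) : Prop :=
  exists h hinv : nat -> R -> R,
    (forall n, Diff1p (h n) /\ is_inv01 (h n) (hinv n)) /\
    forall g, G g -> C1_seq_to_id (fun n x => h n (g (hinv n x))).

(* Main.v *)
Require Import Defs.
From Stdlib Require Import ZArith Reals Lra Lia IndefiniteDescription Classical.
From Coquelicot Require Import Coquelicot.
Open Scope R_scope.

(** Since no fixed point of [f] is hyperbolic, the derivatives of [f^k] and
    [f^-k] grow subexponentially.  Hence for any path [P] of diffeomorphisms and
    weights [w_k] decreasing geometrically at a slow enough rate, the average of
    [P o f^(k+1)] and [P o f^-k] with weights [w_k], [0 <= k <= N], has a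
    derivative [e] for which [e(f x) f'(x) / e(x)] is uniformly close to [1]: the
    two halves of the sum telescope into each other, and the terms at both ends
    are killed by the weights.  To control [G] too, [P] is chosen to carry most of
    the mass of the component of [{f <> id}] that contains the fundamental domain
    [J] as a fixed bump spread over [J] and [f J], pulled back by [h_t] on [J] and
    by [f h_t f^-1] on [f J].  On [J] the density [e] is then nearly a multiple of
    [kap(h_t x) h_t'(x)] for a fixed positive [kap], and on such a density [g]
    acts through [h_t g h_t^-1], which tends to the identity.  Both near-invariance
    conditions are convex in [e], so the families obtained for smaller and smaller
    errors, each on its own initial stretch of the path, can be glued with a
    partition of unity in [t].  Conjugation by the primitive [H_t] of [e_t] then
    sends [f], [G], and hence the group they generate, to the identity.

    Everything is done on the line, diffeomorphisms being extended by the
    identity, with [s = 1/(1 - t)] as time. *)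

(** If [e] is the derivative of [H], the derivative of [H g H^-1] at [H x] is [e(g x) g'(x) / e(x)].
    Convergence to the identity is thus a relative condition on the density, insensitive to constant
    factors, and it passes to products and inverses.

    Averaging along orbits settles [f] but leaves open how the density looks inside [J]; the bump
    prescribes it there. A continuous bump on [J] alone would vanish at both ends of [J] and could
    not dominate the rest of the density. Spread over [J] and [f J], its two parts add up on [J],
    the second one pulled back by [f], to something bounded below; the twist by [f h_t f^-1] on
    [f J] makes both parts see the same [h_t]. A little mass stays outside the bump: it keeps the
    density positive and joins it to the density 1 of the identity at the ends of the component.

    All estimates involve bounds on [h_t'], which may degenerate as [t -> 1]. A choice of parameters
    therefore serves a bounded range of times only, and this is what forces the gluing. *)

(** * Diffeomorphisms of the line *)

(** The derivative is carried along as a function, because the construction works with densities and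
    recovers the maps from them. The last clause covers 0 and 1 themselves: derivative 1 there is
    what lets a map continue as the identity. *)
Definition line_diffeo (F dF : R -> R) : Prop :=
  (forall x, is_derive F x (dF x)) /\ (forall x, continuity_pt dF x) /\
  (forall x, 0 < dF x) /\ (forall x, ~ (0 < x < 1) -> F x = x /\ dF x = 1).

Lemma line_diffeo_derive F dF x : line_diffeo F dF -> is_derive F x (dF x).
Proof. intros H; apply H. Qed.

Lemma is_derive_continuity_pt F x d : is_derive F x d -> continuity_pt F x.
Proof.
intros H. apply derivable_continuous_pt. exists d. now apply is_derive_Reals.
Qed.

Lemma line_diffeo_cont F dF x : line_diffeo F dF -> continuity_pt F x.
Proof. intros H. apply is_derive_continuity_pt with (dF x). apply H. Qed.

Lemma line_diffeo_incr F dF x y : line_diffeo F dF -> x < y -> F x < F y.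
Proof.
intros H Hxy.
destruct (MVT_gen F x y dF) as [c [_ Hc]].
- intros; apply H.
- intros; apply line_diffeo_cont with dF; exact H.
- assert (0 < dF c * (y - x)); [|lra].
  apply Rmult_lt_0_compat; [apply H|lra].
Qed.

Lemma line_diffeo_le F dF x y : line_diffeo F dF -> x <= y -> F x <= F y.
Proof.
intros H [Hxy| ->]; [|lra]. left; eapply line_diffeo_incr; eauto.
Qed.

Lemma line_diffeo_le_inv F dF x y : line_diffeo F dF -> F x <= F y -> x <= y.
Proof.
intros H Hle. destruct (Rle_lt_dec x y) as [|Hlt]; [assumption|].
generalize (line_diffeo_incr F dF y x H Hlt); lra.
Qed.

Lemma line_diffeo_lt_inv F dF x y : line_diffeo F dF -> F x < F y -> x < y.
Proof.
intros H Hle. destruct (Rlt_le_dec x y) as [|Hlt]; [assumption|].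
generalize (line_diffeo_le F dF y x H Hlt); lra.
Qed.

Lemma line_diffeo_0 F dF : line_diffeo F dF -> F 0 = 0.
Proof. intros H; apply H; lra. Qed.

Lemma line_diffeo_1 F dF : line_diffeo F dF -> F 1 = 1.
Proof. intros H; apply H; lra. Qed.

Lemma line_diffeo_I01 F dF x : line_diffeo F dF -> I01 x -> I01 (F x).
Proof.
intros H [H0 H1]; split.
- rewrite <- (line_diffeo_0 F dF H). eapply line_diffeo_le; eauto.
- rewrite <- (line_diffeo_1 F dF H). eapply line_diffeo_le; eauto.
Qed.

Lemma line_diffeo_out F dF x : line_diffeo F dF -> ~ (0 < x < 1) -> F x = x.
Proof. intros H; apply H. Qed.

Lemma line_diffeo_id : line_diffeo (fun x => x) (fun _ => 1).
Proof.
split; [|split; [|split]]; intros; try lra.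
- apply (is_derive_id x).
- apply continuity_pt_const; intros u v; reflexivity.
Qed.

Lemma line_diffeo_comp F dF G dG : line_diffeo F dF -> line_diffeo G dG ->
  line_diffeo (fun x => F (G x)) (fun x => dF (G x) * dG x).
Proof.
intros HF HG; split; [|split; [|split; [|split]]].
- intros x. rewrite Rmult_comm.
  apply (is_derive_comp F G x (dF (G x)) (dG x)); [apply HF|apply HG].
- intros x. apply continuity_pt_mult; [|apply HG].
  apply (continuity_pt_comp G dF); [eapply line_diffeo_cont; eauto|apply HF].
- intros x; apply Rmult_lt_0_compat; [apply HF|apply HG].
- rewrite (line_diffeo_out G dG x HG H). now apply HF.
- rewrite (line_diffeo_out G dG x HG H).
  destruct HF as (_ & _ & _ & HF). destruct HG as (_ & _ & _ & HG).
  rewrite (proj2 (HF x H)), (proj2 (HG x H)); lra.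
Qed.

(** Caratheodory's form of differentiability: the difference quotient, completed on the diagonal, is
    continuous at [x]. It replaces the chain rule for inverses and for compositions with the
    non-differentiable [clamp]. *)
Lemma is_derive_slope F x d : is_derive F x d ->
  exists p : R -> R, p x = d /\ continuity_pt p x /\
    forall y, F y - F x = p y * (y - x).
Proof.
intros H.
exists (fun y => if Req_EM_T y x then d else (F y - F x) / (y - x)).
split; [|split].
- destruct (Req_EM_T x x); congruence.
- intros eps Heps. apply is_derive_Reals in H.
  destruct (H eps Heps) as [del Hdel].
  exists del; split; [apply cond_pos|].
  intros y [[_ Hne] Hy]. unfold R_dist in *; simpl in *. unfold Rdist in *.
  destruct (Req_EM_T x x); [|congruence].
  destruct (Req_EM_T y x) as [->|Hyx]; [congruence|].
  specialize (Hdel (y - x)).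
  replace (x + (y - x)) with y in Hdel by ring.
  apply Hdel; [lra|exact Hy].
- intros y. destruct (Req_EM_T y x) as [->|Hyx]; [ring|field; lra].
Qed.

Lemma slope_is_derive F x p : continuity_pt p x ->
  (forall y, F y - F x = p y * (y - x)) -> is_derive F x (p x).
Proof.
intros Hp HF. apply is_derive_Reals. intros eps Heps.
destruct (Hp eps Heps) as [del [Hdel H]].
exists (mkposreal del Hdel); simpl. intros z Hz Hzd.
replace ((F (x + z) - F x) / z) with (p (x + z))
  by (rewrite HF; field; exact Hz).
apply (H (x + z)). split; [split; [exact I|lra]|].
simpl; unfold Rdist. replace (x + z - x) with z by ring. exact Hzd.
Qed.

Lemma line_diffeo_inv F dF : line_diffeo F dF ->
  exists G dG, line_diffeo G dG /\ (forall x, F (G x) = x) /\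
    (forall x, G (F x) = x).
Proof.
intros HF.
assert (Hs : forall y, exists x, F x = y).
{ intros y. destruct (classic (0 < y < 1)) as [Hy|Hy].
  - destruct (IVT_gen F 0 1 y) as [x [_ Hx]]; [|
      rewrite (line_diffeo_0 F dF HF), (line_diffeo_1 F dF HF),
        Rmin_left, Rmax_right; lra|now exists x].
    intros x; eapply line_diffeo_cont; eauto.
  - exists y. now apply (line_diffeo_out F dF). }
destruct (functional_choice _ Hs) as [G HG].
assert (HGF : forall x, G (F x) = x).
{ intros x. apply Rle_antisym; apply (line_diffeo_le_inv F dF _ _ HF);
    rewrite HG; lra. }
exists G, (fun y => / dF (G y)); split; [|now split].
assert (Gc : forall y, continuity_pt G y).
{ intros y eps Heps.
  assert (H1 : F (G y - eps) < y) by (rewrite <- (HG y) at 2;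
    apply (line_diffeo_incr F dF _ _ HF); lra).
  assert (H2 : y < F (G y + eps)) by (rewrite <- (HG y) at 1;
    apply (line_diffeo_incr F dF _ _ HF); lra).
  exists (Rmin (y - F (G y - eps)) (F (G y + eps) - y)).
  split; [apply Rmin_glb_lt; lra|].
  intros z [_ Hz]. simpl in *; unfold Rdist in *.
  assert (Ha := Rlt_le_trans _ _ _ Hz (Rmin_l _ _)).
  assert (Hb := Rlt_le_trans _ _ _ Hz (Rmin_r _ _)).
  apply Rabs_def2 in Ha. apply Rabs_def2 in Hb.
  apply Rabs_def1.
  - enough (G z < G y + eps) by lra.
    apply (line_diffeo_lt_inv F dF _ _ HF). rewrite HG; lra.
  - enough (G y - eps < G z) by lra.
    apply (line_diffeo_lt_inv F dF _ _ HF). rewrite HG; lra. }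
assert (Hpos : forall x, 0 < dF x) by apply HF.
split; [|split; [|split; [|split]]].
- intros y.
  destruct (is_derive_slope F (G y) (dF (G y)) (line_diffeo_derive _ _ _ HF))
    as [p [Hp [Hpc Hpe]]].
  rewrite <- Hp.
  apply (slope_is_derive G y (fun z => / p (G z))).
  + apply continuity_pt_inv; [apply (continuity_pt_comp G p); auto|].
    rewrite Hp. apply Rgt_not_eq, Hpos.
  + intros z. specialize (Hpe (G z)). rewrite 2!HG in Hpe. rewrite Hpe.
    (* The slope cannot vanish: that would force [z = y], where its value is [dF (G y) > 0]. *)
    field. intros H0. rewrite H0, Rmult_0_l in Hpe.
    assert (z = y) by lra. subst z. rewrite Hp in H0.
    generalize (Hpos (G y)); lra.
- intros y. apply continuity_pt_inv; [|apply Rgt_not_eq, Hpos].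
  apply (continuity_pt_comp G dF); [apply Gc|apply HF].
- intros y. apply Rinv_0_lt_compat, Hpos.
- rewrite <- (line_diffeo_out F dF x HF H) at 1. apply HGF.
- assert (G x = x) as ->.
  { rewrite <- (line_diffeo_out F dF x HF H) at 1. apply HGF. }
  destruct HF as (_ & _ & _ & HF). rewrite (proj2 (HF x H)). lra.
Qed.

(** * Iteration *)

Fixpoint iter_deriv (f df : R -> R) (k : nat) (x : R) : R :=
  match k with
  | O => 1
  | S k => df (Nat.iter k f x) * iter_deriv f df k x
  end.

Lemma line_diffeo_iter f df k : line_diffeo f df ->
  line_diffeo (Nat.iter k f) (iter_deriv f df k).
Proof.
intros Hf. induction k as [|k IH]; [exact line_diffeo_id|].
exact (line_diffeo_comp f df (Nat.iter k f) (iter_deriv f df k) Hf IH).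
Qed.

Lemma iter_swap {T} (f : T -> T) k x : Nat.iter k f (f x) = f (Nat.iter k f x).
Proof. induction k as [|k IH]; simpl; congruence. Qed.

(** The definition peels off the last application of [f]; pulling a density back by [f] needs the
    first one. *)
Lemma iter_deriv_S_head f df k x :
  iter_deriv f df (S k) x = iter_deriv f df k (f x) * df x.
Proof.
induction k as [|k IH]; [simpl; ring|].
change (df (Nat.iter (S k) f x) * iter_deriv f df (S k) x =
  df (Nat.iter k f (f x)) * iter_deriv f df k (f x) * df x).
rewrite IH, iter_swap; simpl; ring.
Qed.

Lemma iter_fix {T} (f : T -> T) k x : f x = x -> Nat.iter k f x = x.
Proof. intros H; induction k as [|k IH]; simpl; congruence. Qed.

Lemma exp_le_mono x y : x <= y -> exp x <= exp y.
Proof.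
intros [H| ->]; [left; now apply exp_increasing|lra].
Qed.

(* Near the fixed points the derivative is below [g]; away from them the
   displacement pays for it, and displacements sum to at most 1 along an
   orbit. *)
Lemma iter_deriv_growth f df g : line_diffeo f df ->
  (forall x, f x = x -> df x = 1) -> 1 < g ->
  exists C, 0 < C /\ forall k x, iter_deriv f df k x <= C * g ^ k.
Proof.
intros Hf Hfix Hg.
(* Positive at every point: either the point moves, or its derivative is 1 and [g - 1 > 0]. With [m]
   the minimum on [[0, 1]], a point of [[0, 1]] whose derivative exceeds [g] moves by at least
   [m]. *)
set (psi := fun x => Rabs (f x - x) + Rmax 0 (g - df x)).
assert (Hfc : forall x, continuity_pt f x) by
  (intros; eapply line_diffeo_cont; eauto).
assert (Hdc : forall x, continuity_pt df x) by apply Hf.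
assert (Hpos : forall x, 0 < df x) by apply Hf.
assert (Hfd : forall x, continuity_pt (fun x => f x - x) x).
{ intros x. apply (continuity_pt_minus f (fun x => x)); [apply Hfc|].
  apply derivable_continuous_pt, derivable_pt_id. }
assert (Hpsi : forall x, continuity_pt psi x).
{ intros x. apply (continuity_pt_plus (fun x => Rabs (f x - x))
    (fun x => Rmax 0 (g - df x))).
  - apply (continuity_pt_comp (fun x => f x - x) Rabs); [apply Hfd|].
    apply Rcontinuity_abs.
  - apply continuity_pt_ext with (fun x => (Rabs (g - df x) + (g - df x)) * / 2).
    + intros y. unfold Rmax, Rabs.
      destruct (Rcase_abs (g - df y)); destruct (Rle_dec 0 (g - df y)); lra.
    + assert (continuity_pt (fun x => g - df x) x).
      { apply (continuity_pt_minus (fun _ => g) df); [|apply Hdc].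
        apply continuity_pt_const; intros u v; reflexivity. }
      apply (continuity_pt_mult (fun x => Rabs (g - df x) + (g - df x))
        (fun _ => / 2)).
      * apply (continuity_pt_plus (fun x => Rabs (g - df x))
          (fun x => g - df x)); [|assumption].
        apply (continuity_pt_comp (fun x => g - df x) Rabs); [assumption|].
        apply Rcontinuity_abs.
      * apply continuity_pt_const; intros u v; reflexivity. }
destruct (continuity_ab_min psi 0 1) as [x1 [Hm _]]; [lra|auto|].
destruct (continuity_ab_maj df 0 1) as [x2 [HM _]]; [lra|auto|].
set (m := psi x1) in *. set (M := df x2) in *.
assert (Hm0 : 0 < m).
{ unfold m, psi. destruct (Req_dec (f x1) x1) as [He|Hne].
  - rewrite (Hfix _ He). generalize (Rabs_pos (f x1 - x1)).
    generalize (Rmax_r 0 (g - 1)); lra.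
  - generalize (Rabs_pos_lt (f x1 - x1)). generalize (Rmax_l 0 (g - df x1)).
    lra. }
assert (HMp : 0 < M) by apply Hpos.
set (L := M / m).
assert (HL : 0 < L) by (apply Rdiv_lt_0_compat; assumption).
assert (Hloc : forall x, df x <= g * exp (L * Rabs (f x - x))).
{ intros x.
  assert (He : 1 <= exp (L * Rabs (f x - x))).
  { rewrite <- exp_0. apply exp_le_mono.
    apply Rmult_le_pos; [lra|apply Rabs_pos]. }
  destruct (classic (0 < x < 1)) as [Hx|Hx].
  2:{ destruct Hf as (_ & _ & _ & Hf). rewrite (proj2 (Hf x Hx)). nra. }
  assert (Hmx : m <= psi x) by (apply Hm; lra). unfold psi in Hmx.
  destruct (Rle_lt_dec (df x) g) as [Hle|Hlt]; [nra|].
  rewrite Rmax_left in Hmx by lra.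
  assert (HMx : df x <= M) by (apply HM; lra).
  (* The displacement is at least [m] here, so the exponent is at least [M], and [exp] exceeds its
     argument. *)
  assert (M <= L * Rabs (f x - x)).
  { replace M with (L * m) by (unfold L; field; lra).
    apply Rmult_le_compat_l; lra. }
  generalize (exp_ineq1_le (L * Rabs (f x - x))). nra. }
exists (exp L); split; [apply exp_pos|].
assert (Hit : forall k, line_diffeo (Nat.iter k f) (iter_deriv f df k)) by
  (intros; now apply line_diffeo_iter).
assert (Hdp : forall k x, 0 < iter_deriv f df k x) by (intros k x;
  apply (Hit k)).
assert (Hg0 : forall k, 0 < g ^ k) by (intros; apply pow_lt; lra).
assert (Hk : forall k x, iter_deriv f df k x <=
  g ^ k * exp (L * Rabs (Nat.iter k f x - x))).
{ intros k x.
  (* Orbits are monotone, so absolute displacements add up without cancellation. *)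
  assert (Hmon : (forall k, Nat.iter k f x <= f (Nat.iter k f x)) \/
    (forall k, f (Nat.iter k f x) <= Nat.iter k f x)).
  { destruct (Rle_dec x (f x)) as [Hle|Hle]; [left|right]; intros j;
      induction j as [|j IH]; simpl; try lra;
      apply (line_diffeo_le f df _ _ Hf); exact IH. }
  induction k as [|k IH].
  - simpl. unfold Rminus. rewrite Rplus_opp_r, Rabs_R0, Rmult_0_r, exp_0. lra.
  - simpl. set (y := Nat.iter k f x) in *.
    replace (L * Rabs (f y - x)) with
      (L * Rabs (f y - y) + L * Rabs (y - x)).
    + rewrite exp_plus.
      apply Rle_trans with ((g * exp (L * Rabs (f y - y))) *
        (g ^ k * exp (L * Rabs (y - x)))).
      * apply Rmult_le_compat; try apply Hloc; try exact IH.
        -- left; apply Hpos.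
        -- left; apply Hdp.
      * right; ring.
    + rewrite <- Rmult_plus_distr_l. f_equal. unfold y.
      assert (Hx : forall j, (x <= Nat.iter j f x /\
        forall k, Nat.iter k f x <= f (Nat.iter k f x)) \/
        (Nat.iter j f x <= x /\
        forall k, f (Nat.iter k f x) <= Nat.iter k f x)).
      { intros j. destruct Hmon as [H|H]; [left|right]; (split; [|exact H]);
          induction j as [|j IHj]; simpl; try lra;
          specialize (H j); lra. }
      destruct (Hx k) as [[H1 H2]|[H1 H2]]; specialize (H2 k);
      [rewrite 3!Rabs_right|rewrite 3!Rabs_left1]; lra. }
intros k x. apply Rle_trans with (1 := Hk k x).
rewrite Rmult_comm. apply Rmult_le_compat_r; [left; apply Hg0|].
apply exp_le_mono. rewrite <- (Rmult_1_r L) at 2. apply Rmult_le_compat_l; [lra|].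
destruct (classic (0 < x < 1)) as [Hx|Hx].
- assert (I01 (Nat.iter k f x)) as [H0 H1].
  { apply (line_diffeo_I01 _ _ x (Hit k)); split; lra. }
  apply Rabs_le; lra.
- rewrite iter_fix by (apply (line_diffeo_out f df x Hf Hx)).
  unfold Rminus. rewrite Rplus_opp_r, Rabs_R0; lra.
Qed.

(** * Joint continuity *)

Definition jointly_continuous (a : R -> R -> R) : Prop :=
  forall s x, continuity_2d_pt a s x.

Lemma jcont_comp a b : jointly_continuous a -> jointly_continuous b ->
  jointly_continuous (fun s x => a s (b s x)).
Proof.
intros Ha Hb s x eps.
destruct (Ha s (b s x) eps) as [d1 H1].
destruct (Hb s x d1) as [d2 H2].
assert (Hd : 0 < Rmin d1 d2) by (apply Rmin_glb_lt; apply cond_pos).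
exists (mkposreal _ Hd); simpl. intros u v Hu Hv.
apply H1.
- apply Rlt_le_trans with (1 := Hu), Rmin_l.
- apply H2; eapply Rlt_le_trans; eauto; apply Rmin_r.
Qed.

Lemma jcont_snd u : (forall x, continuity_pt u x) ->
  jointly_continuous (fun _ x => u x).
Proof.
intros Hu s x.
apply (continuity_1d_2d_pt_comp u (fun _ x => x)); [apply Hu|].
apply continuity_2d_pt_id2.
Qed.

Lemma jcont_fst u : (forall x, continuity_pt u x) ->
  jointly_continuous (fun s _ => u s).
Proof.
intros Hu s x.
apply (continuity_1d_2d_pt_comp u (fun s _ => s)); [apply Hu|].
apply continuity_2d_pt_id1.
Qed.

Lemma jcont_const c : jointly_continuous (fun _ _ => c).
Proof. intros s x; apply continuity_2d_pt_const. Qed.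

Lemma jcont_plus a b : jointly_continuous a -> jointly_continuous b ->
  jointly_continuous (fun s x => a s x + b s x).
Proof. intros Ha Hb s x; now apply continuity_2d_pt_plus. Qed.

Lemma jcont_mult a b : jointly_continuous a -> jointly_continuous b ->
  jointly_continuous (fun s x => a s x * b s x).
Proof. intros Ha Hb s x; now apply continuity_2d_pt_mult. Qed.

Lemma jcont_sum (a : nat -> R -> R -> R) n :
  (forall k, jointly_continuous (a k)) ->
  jointly_continuous (fun s x => sum_f_R0 (fun k => a k s x) n).
Proof.
intros Ha; induction n as [|n IH]; simpl; [apply Ha|now apply jcont_plus].
Qed.

Lemma jcont_section a s x : jointly_continuous a -> continuity_pt (a s) x.
Proof.
intros Ha eps Heps. destruct (Ha s x (mkposreal eps Heps)) as [d Hd].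
exists d; split; [apply cond_pos|]. intros y [_ Hy].
apply Hd; [|exact Hy]. unfold Rminus; rewrite Rplus_opp_r, Rabs_R0.
apply cond_pos.
Qed.

(** By uniform continuity [a] grows by at most 1 when [s] advances by [d / 2]; the induction counts
    such steps, starting from the maximum of [a 0]. *)
Lemma jcont_bounded a T : jointly_continuous a ->
  exists M, forall s x, 0 <= s <= T -> 0 <= x <= 1 -> a s x <= M.
Proof.
intros Ha.
destruct (uniform_continuity_2d a 0 T 0 1 (fun s x _ _ => Ha s x)
  (mkposreal 1 Rlt_0_1)) as [d Hd]; simpl in Hd.
destruct (continuity_ab_maj (a 0) 0 1) as [x0 [HM _]];
  [lra|intros; now apply jcont_section|].
assert (Hd0 := cond_pos d).
assert (Hind : forall n s x, 0 <= s <= T -> 0 <= x <= 1 ->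
  s <= INR n * (d / 2) -> a s x <= a 0 x0 + INR n).
{ induction n as [|n IH]; intros s x Hs Hx Hn.
  - simpl in *. replace s with 0 by lra. specialize (HM x Hx); lra.
  - rewrite S_INR in *.
    destruct (Rle_dec s (INR n * (d / 2))) as [Hle|Hle].
    + specialize (IH s x Hs Hx Hle); lra.
    + assert (0 <= INR n * (d / 2)) by
        (apply Rmult_le_pos; [apply pos_INR|lra]).
      assert (H1 : 0 <= INR n * (d / 2) <= T) by lra.
      specialize (IH _ x H1 Hx (Rle_refl _)).
      specialize (Hd (INR n * (d / 2)) x s x H1 Hx Hs Hx).
      assert (Ht := Rabs_def2 _ _ (Hd ltac:(apply Rabs_def1; lra)
        ltac:(unfold Rminus; rewrite Rplus_opp_r, Rabs_R0; lra))). lra. }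
destruct (INR_archimed (d / 2) T) as [n Hn]; [lra|].
exists (a 0 x0 + INR n). intros s x Hs Hx. apply Hind; lra.
Qed.

Lemma jcont_bounded_below a T : jointly_continuous a ->
  (forall s x, 0 < a s x) ->
  exists m, 0 < m /\ forall s x, 0 <= s <= T -> 0 <= x <= 1 -> m <= a s x.
Proof.
intros Ha Hp.
destruct (jcont_bounded (fun s x => / a s x) T) as [M HM].
- intros s x. apply continuity_2d_pt_inv; [apply Ha|].
  apply Rgt_not_eq, Hp.
- assert (0 < Rmax 1 M) by (apply Rlt_le_trans with 1; [lra|apply Rmax_l]).
  exists (/ Rmax 1 M); split; [now apply Rinv_0_lt_compat|].
  intros s x Hs Hx. rewrite <- (Rinv_inv (a s x)).
  apply Rinv_le_contravar; [apply Rinv_0_lt_compat, Hp|].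
  apply Rle_trans with M; [now apply HM|apply Rmax_r].
Qed.

(** * Convex combinations *)

Lemma sum_mult_pos (l a : nat -> R) n :
  (forall k, 0 <= l k) -> (forall k, 0 < a k) -> 0 < sum_f_R0 l n ->
  0 < sum_f_R0 (fun k => l k * a k) n.
Proof.
intros Hl Ha. induction n as [|n IH]; simpl; intros Hs.
- now apply Rmult_lt_0_compat.
- assert (0 <= l (S n) * a (S n)) by
    (apply Rmult_le_pos; [apply Hl|left; apply Ha]).
  assert (0 <= sum_f_R0 (fun k => l k * a k) n) by
    (apply cond_pos_sum; intros; apply Rmult_le_pos; [apply Hl|left; apply Ha]).
  destruct (Rlt_le_dec 0 (sum_f_R0 l n)) as [H1|H1]; [specialize (IH H1); lra|].
  assert (0 < l (S n) * a (S n)); [|lra].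
  apply Rmult_lt_0_compat; [lra|apply Ha].
Qed.

Lemma sum_same (l : nat -> R) c n :
  sum_f_R0 (fun k => l k * c) n = sum_f_R0 l n * c.
Proof. rewrite (Rmult_comm _ c), scal_sum; apply sum_eq; intros; ring. Qed.

Lemma is_derive_sum_f_R0 (E e : nat -> R -> R) n x :
  (forall k, is_derive (E k) x (e k x)) ->
  is_derive (fun y => sum_f_R0 (fun k => E k y) n) x
    (sum_f_R0 (fun k => e k x) n).
Proof.
intros H; induction n as [|n IH]; simpl; [apply H|].
apply (is_derive_plus (fun y => sum_f_R0 (fun k => E k y) n) (E (S n)));
  [exact IH|apply H].
Qed.

Lemma continuity_sum_f_R0 (e : nat -> R -> R) n x :
  (forall k, continuity_pt (e k) x) ->
  continuity_pt (fun y => sum_f_R0 (fun k => e k y) n) x.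
Proof.
intros H; induction n as [|n IH]; simpl; [apply H|].
apply (continuity_pt_plus (fun y => sum_f_R0 (fun k => e k y) n) (e (S n)));
  [exact IH|apply H].
Qed.

Lemma line_diffeo_convex (l : nat -> R) (E e : nat -> R -> R) n :
  (forall k, 0 <= l k) -> sum_f_R0 l n = 1 ->
  (forall k, line_diffeo (E k) (e k)) ->
  line_diffeo (fun x => sum_f_R0 (fun k => l k * E k x) n)
    (fun x => sum_f_R0 (fun k => l k * e k x) n).
Proof.
intros Hl H1 HE; split; [|split; [|split]].
- intros x. apply (is_derive_sum_f_R0 (fun k x => l k * E k x) (fun k x => l k * e k x)).
  intros k. apply (is_derive_scal (E k) x (l k) (e k x)), HE.
- intros x. apply (continuity_sum_f_R0 (fun k x => l k * e k x)).
  intros k. apply (continuity_pt_mult (fun _ => l k)); [|apply HE].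
  apply continuity_pt_const; intros u v; reflexivity.
- intros x. apply sum_mult_pos; [exact Hl| |rewrite H1; lra].
  intros k; apply HE.
- intros x Hx.
  rewrite (sum_eq _ (fun k => l k * x)), (sum_eq (fun k => l k * e k x)
    (fun k => l k * 1)), 2!sum_same, H1; [lra| |];
  intros k _; destruct (HE k) as (_ & _ & _ & H); destruct (H x Hx) as [A B];
  [now rewrite B|now rewrite A].
Qed.

Lemma line_diffeo_mid F dF G dG : line_diffeo F dF -> line_diffeo G dG ->
  line_diffeo (fun x => (F x + G x) / 2) (fun x => (dF x + dG x) / 2).
Proof.
intros HF HG; split; [|split; [|split]].
- intros x. apply is_derive_ext with (fun x => / 2 * (F x + G x)).
  + intros t; apply Rmult_comm.
  + replace ((dF x + dG x) / 2) with (/ 2 * (dF x + dG x)) by (unfold Rdiv; ring).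
    apply (is_derive_scal (fun x => F x + G x)).
    apply (is_derive_plus F G); [apply HF|apply HG].
- intros x. apply (continuity_pt_mult (fun x => dF x + dG x) (fun _ => / 2)).
  + apply continuity_pt_plus; [apply HF|apply HG].
  + apply continuity_pt_const; intros u v; reflexivity.
- intros x. assert (0 < dF x) by apply HF. assert (0 < dG x) by apply HG. lra.
- intros x Hx. destruct HF as (_ & _ & _ & HF), HG as (_ & _ & _ & HG).
  specialize (HF x Hx); specialize (HG x Hx). lra.
Qed.

Lemma pow_le_pow_small r m n : 0 <= r <= 1 -> (m <= n)%nat -> r ^ n <= r ^ m.
Proof.
intros Hr Hmn. replace n with (m + (n - m))%nat by lia. rewrite pow_add.
rewrite <- (Rmult_1_r (r ^ m)) at 2. apply Rmult_le_compat_l; [now apply pow_le|].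
rewrite <- (pow1 (n - m)). now apply pow_incr.
Qed.

(** * Weighted averages along orbits *)

(** For [p = P'] and [fi] the inverse of [f], the derivative of the sum of
    [rho^(2k) (P o f^(k+1) + P o f^-k)]. The weight is a square because one factor [rho^k] has to
    absorb the growth of the derivatives of the iterates while the other still decays. Forward
    exponents start at 1, so that no iterate occurs twice. *)
Definition orbit_sum (f df fi dfi p : R -> R) (rho : R) (N : nat) (x : R) : R :=
  sum_f_R0 (fun k => (rho ^ 2) ^ k *
    (p (Nat.iter (S k) f x) * iter_deriv f df (S k) x +
     p (Nat.iter k fi x) * iter_deriv fi dfi k x)) N.

(** [D] and [B] are the forward and backward terms, the primed sequences their pullbacks by [f]:
    indices move by one and [D 0] crosses from one half to the other. The shift changes weights by a
    factor [/ r] or [r], whence the relative error [/ r - 1]; the two extra terms are the one that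
    enters and the one that leaves at the ends. *)
Lemma shifted_weighted_sum (D B D' B' : nat -> R) r N : 0 < r < 1 ->
  (forall k, 0 <= D k) -> (forall k, 0 <= B k) ->
  (forall k, D' k = D (S k)) -> B' O = D O -> (forall k, B' (S k) = B k) ->
  Rabs (sum_f_R0 (fun k => r ^ k * (D' k + B' k)) N -
        sum_f_R0 (fun k => r ^ k * (D k + B k)) N) <=
  (/ r - 1) * sum_f_R0 (fun k => r ^ k * (D k + B k)) N +
  r ^ N * D (S N) + r ^ N * B N.
Proof.
intros Hr HD HB HD' HB0 HB'.
set (S0 := sum_f_R0 (fun k => r ^ k * (D k + B k))).
set (S1 := sum_f_R0 (fun k => r ^ k * (D' k + B' k))).
assert (Hq : 0 < / r - 1).
{ assert (1 < / r); [|lra]. rewrite <- Rinv_1. apply Rinv_lt_contravar; lra. }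
assert (Hq' : 1 - r <= / r - 1).
{ replace (/ r - 1) with ((1 - r) * / r) by (field; lra). nra. }
assert (Hp : forall k, 0 < r ^ k) by (intros; apply pow_lt; lra).
(* Strengthened for the induction: the end terms are subtracted exactly, and [B N], whose shifted
   copy has not yet appeared, does not count in the bound. *)
assert (H : Rabs (S1 N - S0 N - r ^ N * (D (S N) - B N)) <=
  (/ r - 1) * (S0 N - r ^ N * B N)).
{ induction N as [|N IH].
  - unfold S0, S1; simpl. rewrite HD', HB0.
    replace (1 * (D 1%nat + D 0%nat) - 1 * (D 0%nat + B 0%nat) -
      1 * (D 1%nat - B 0%nat)) with 0 by ring.
    rewrite Rabs_R0. apply Rmult_le_pos; [lra|].
    generalize (HD O); lra.
  - set (X := S1 N - S0 N - r ^ N * (D (S N) - B N)) in *.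
    set (Y := S0 N - r ^ N * B N) in *.
    replace (S1 (S N) - S0 (S N) - r ^ S N * (D (S (S N)) - B (S N)))
      with (X + ((r ^ N * (1 - r)) * D (S N) - (r ^ N * (1 - r)) * B N)).
    2:{ unfold X, S1, S0; rewrite 2!tech5, HD', HB'; simpl; ring. }
    replace ((/ r - 1) * (S0 (S N) - r ^ S N * B (S N))) with
      ((/ r - 1) * Y + (r ^ N * (1 - r) * D (S N) + (/ r - 1) * (r ^ N * B N))).
    2:{ unfold Y, S0; rewrite tech5; simpl; field; lra. }
    apply Rle_trans with (1 := Rabs_triang _ _).
    apply Rplus_le_compat; [exact IH|].
    assert (0 <= r ^ N * (1 - r) * D (S N)).
    { apply Rmult_le_pos; [|apply HD]. apply Rmult_le_pos; [left; apply Hp|lra]. }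
    assert (0 <= r ^ N * (1 - r) * B N).
    { apply Rmult_le_pos; [|apply HB]. apply Rmult_le_pos; [left; apply Hp|lra]. }
    assert (r ^ N * (1 - r) * B N <= (/ r - 1) * (r ^ N * B N)).
    { replace (r ^ N * (1 - r) * B N) with ((1 - r) * (r ^ N * B N)) by ring.
      apply Rmult_le_compat_r; [|exact Hq'].
      apply Rmult_le_pos; [left; apply Hp|apply HB]. }
    apply Rabs_le; lra. }
assert (0 <= r ^ N * B N) by (apply Rmult_le_pos; [left; apply Hp|apply HB]).
assert (0 <= r ^ N * D (S N)) by
  (apply Rmult_le_pos; [left; apply Hp|apply HD]).
apply Rabs_le_between in H. apply Rabs_le.
assert (0 <= (/ r - 1) * (r ^ N * B N)) by (apply Rmult_le_pos; lra).
lra.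
Qed.

Section OrbitSum.
Variables (f df fi dfi : R -> R) (rho C : R).
Hypotheses (Hf : line_diffeo f df) (Hfi : line_diffeo fi dfi)
  (Hfif : forall x, fi (f x) = x)
  (Hrho : 0 < rho < 1)
  (HCf : forall k x, iter_deriv f df k x * rho ^ k <= C)
  (HCfi : forall k x, iter_deriv fi dfi k x * rho ^ k <= C).

Lemma dfi_df x : dfi (f x) * df x = 1.
Proof.
assert (H1 : is_derive (fun x => fi (f x)) x (dfi (f x) * df x)).
{ apply (line_diffeo_comp fi dfi f df Hfi Hf). }
assert (H2 : is_derive (fun x => fi (f x)) x 1).
{ apply is_derive_ext with (fun x => x); [intros; now rewrite Hfif|].
  apply (is_derive_id x). }
rewrite <- (is_derive_unique _ _ _ H1). exact (is_derive_unique _ _ _ H2).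
Qed.

Lemma iter_deriv_pos g dg k x : line_diffeo g dg -> 0 < iter_deriv g dg k x.
Proof. intros Hg; apply (line_diffeo_iter g dg k Hg). Qed.

Lemma orbit_sum_almost_invariant p N m M eta x :
  (forall x, 0 < p x) -> (forall x, m <= p x <= M) -> 0 < m ->
  / rho ^ 2 - 1 <= eta / 2 -> C * M * rho ^ N <= eta / 4 * m * rho ^ 2 ->
  Rabs (orbit_sum f df fi dfi p rho N (f x) * df x -
        orbit_sum f df fi dfi p rho N x) <=
  eta * orbit_sum f df fi dfi p rho N x.
Proof.
intros Hp Hb Hm He HN.
set (D := fun k => p (Nat.iter (S k) f x) * iter_deriv f df (S k) x).
set (B := fun k => p (Nat.iter k fi x) * iter_deriv fi dfi k x).
set (D' := fun k => p (Nat.iter (S k) f (f x)) *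
  iter_deriv f df (S k) (f x) * df x).
set (B' := fun k => p (Nat.iter k fi (f x)) * iter_deriv fi dfi k (f x) * df x).
assert (HD : forall k, 0 <= D k).
{ intros; apply Rmult_le_pos; [left; apply Hp|left; now apply iter_deriv_pos]. }
assert (HB : forall k, 0 <= B k).
{ intros; apply Rmult_le_pos; [left; apply Hp|left; now apply iter_deriv_pos]. }
assert (H := shifted_weighted_sum D B D' B' (rho ^ 2) N).
assert (Hr2 : 0 < rho ^ 2 < 1) by (simpl; nra).
specialize (H Hr2 HD HB).
assert (H1 : forall k, D' k = D (S k)).
{ intros k. unfold D', D. rewrite (iter_deriv_S_head f df (S k) x), (iter_swap f (S k) x).
  change (f (Nat.iter (S k) f x)) with (Nat.iter (S (S k)) f x). ring. }
assert (H2 : B' O = D O) by (unfold B', D; simpl; ring).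
assert (H3 : forall k, B' (S k) = B k).
{ intros k. unfold B', B. 
  assert (Hk : Nat.iter (S k) fi (f x) = Nat.iter k fi x).
  { change (fi (Nat.iter k fi (f x)) = Nat.iter k fi x).
    now rewrite <- iter_swap, Hfif. }
  rewrite iter_deriv_S_head, Hfif, Hk.
  replace (p (Nat.iter k fi x) * (iter_deriv fi dfi k x * dfi (f x)) * df x)
    with (p (Nat.iter k fi x) * iter_deriv fi dfi k x * (dfi (f x) * df x))
    by ring. rewrite dfi_df; ring. }
specialize (H H1 H2 H3).
assert (HS : orbit_sum f df fi dfi p rho N (f x) * df x =
  sum_f_R0 (fun k => (rho ^ 2) ^ k * (D' k + B' k)) N).
{ unfold orbit_sum. rewrite <- sum_same. apply sum_eq. intros k _.
  unfold D', B'. ring. }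
rewrite HS.
change (orbit_sum f df fi dfi p rho N x) with
  (sum_f_R0 (fun k => (rho ^ 2) ^ k * (D k + B k)) N).
apply Rle_trans with (1 := H).
set (S0 := sum_f_R0 (fun k => (rho ^ 2) ^ k * (D k + B k)) N) in *.
assert (HM : 0 < M) by (destruct (Hb x); lra).
assert (HpN : 0 < rho ^ N) by (apply pow_lt; lra).
assert (HC : 0 < C).
{ generalize (HCf 0 x); simpl; lra. }
(* The backward term of index 0 is [p x] with weight 1. This lower bound turns the absolute errors
   at the ends into relative ones. *)
assert (HS0 : m <= S0).
{ apply Rle_trans with (sum_f_R0 (fun k => (rho ^ 2) ^ k * (D k + B k)) 0).
  - simpl. assert (B 0%nat = p x) by (unfold B; simpl; ring).
    generalize (HD O) (Hb x); lra.
  - unfold S0; clear -HD HB Hr2. induction N as [|N IH]; [lra|].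
    rewrite (tech5 _ N). assert (0 <= (rho ^ 2) ^ S N * (D (S N) + B (S N))).
    { apply Rmult_le_pos; [apply pow_le; lra|].
      generalize (HD (S N)) (HB (S N)); lra. } lra. }
(* An end term is at most [rho^(2N) M C rho^-(N+2)]. The exponent [N + 2] is that of the iterate in
   [D (S N)] and explains the factor [rho ^ 2] in the condition on [N]; each of the two ends costs
   [eta / 4]. *)
assert (Hedge : forall q : R, forall j, q * rho ^ j <= C -> (j <= N + 2)%nat ->
  0 < q -> forall y, (rho ^ 2) ^ N * (p y * q) <= eta / 4 * m).
{ intros q j Hq Hj Hq0 y.
  assert (Hq2 : q * rho ^ (N + 2) <= C).
  { apply Rle_trans with (2 := Hq). apply Rmult_le_compat_l; [lra|].
    apply pow_le_pow_small; [lra|lia]. }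
  assert (0 < rho ^ 2) by lra.
  apply Rmult_le_reg_r with (rho ^ 2); [assumption|].
  apply Rle_trans with (2 := HN).
  replace ((rho ^ 2) ^ N * (p y * q) * rho ^ 2) with
    (p y * (q * rho ^ (N + 2)) * rho ^ N).
  2:{ rewrite pow_add, <- pow_mult, Nat.mul_comm, pow_mult. ring. }
  apply Rmult_le_compat_r; [lra|]. rewrite (Rmult_comm C).
  apply Rmult_le_compat; try lra; [left; apply Hp| |apply Hb].
  apply Rmult_le_pos; [lra|apply pow_le; lra]. }
assert (E1 : (rho ^ 2) ^ N * D (S N) <= eta / 4 * m).
{ apply (Hedge _ (S (S N))); [apply HCf|lia|now apply iter_deriv_pos]. }
assert (E2 : (rho ^ 2) ^ N * B N <= eta / 4 * m).
{ apply (Hedge _ N); [apply HCfi|lia|now apply iter_deriv_pos]. }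
assert ((/ rho ^ 2 - 1) * S0 <= eta / 2 * S0) by
  (apply Rmult_le_compat_r; lra).
assert (0 < C * M * rho ^ N) by
  (repeat apply Rmult_lt_0_compat; assumption).
assert (0 <= eta).
{ assert (1 < / rho ^ 2); [|lra]. rewrite <- Rinv_1.
  apply Rinv_lt_contravar; lra. }
assert (eta / 4 * m <= eta / 4 * S0) by (apply Rmult_le_compat_l; lra).
lra.
Qed.

Lemma orbit_sum_plus p q N x :
  orbit_sum f df fi dfi (fun x => p x + q x) rho N x =
  orbit_sum f df fi dfi p rho N x + orbit_sum f df fi dfi q rho N x.
Proof.
unfold orbit_sum. rewrite <- plus_sum. apply sum_eq; intros; ring.
Qed.

Definition orbit_weight (N : nat) : R := sum_f_R0 (fun k => (rho ^ 2) ^ k) N.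

Lemma orbit_weight_pos N : 0 < orbit_weight N.
Proof.
unfold orbit_weight. assert (0 < rho ^ 2) by (apply pow_lt; lra).
induction N as [|N IH]; [simpl; lra|]. rewrite tech5.
generalize (pow_lt _ (S N) H); lra.
Qed.

(** Normalised to a convex combination, since these preserve [line_diffeo] and common fixed
    points. *)
Definition orbit_average (P : R -> R) (N : nat) (x : R) : R :=
  sum_f_R0 (fun k => (rho ^ 2) ^ k / orbit_weight N *
    ((P (Nat.iter (S k) f x) + P (Nat.iter k fi x)) / 2)) N.

Lemma orbit_coeff_sum N :
  sum_f_R0 (fun k => (rho ^ 2) ^ k / orbit_weight N) N = 1.
Proof.
rewrite (sum_eq _ (fun k => (rho ^ 2) ^ k * / orbit_weight N)) by reflexivity.
rewrite sum_same. apply Rinv_r, Rgt_not_eq, orbit_weight_pos.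
Qed.

Lemma orbit_average_diffeo P p N : line_diffeo P p ->
  line_diffeo (orbit_average P N) (fun x =>
    orbit_sum f df fi dfi p rho N x * / (2 * orbit_weight N)).
Proof.
intros HP.
assert (HW := orbit_weight_pos N).
assert (H : line_diffeo (orbit_average P N) (fun x => sum_f_R0 (fun k =>
  (rho ^ 2) ^ k / orbit_weight N *
    ((p (Nat.iter (S k) f x) * iter_deriv f df (S k) x +
     p (Nat.iter k fi x) * iter_deriv fi dfi k x) / 2)) N)).
{ apply (line_diffeo_convex (fun k => (rho ^ 2) ^ k / orbit_weight N)
    (fun k x => (P (Nat.iter (S k) f x) + P (Nat.iter k fi x)) / 2)
    (fun k x => (p (Nat.iter (S k) f x) * iter_deriv f df (S k) x +
     p (Nat.iter k fi x) * iter_deriv fi dfi k x) / 2)).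
  - intros k. left; apply Rdiv_lt_0_compat; [|assumption].
    apply pow_lt, pow_lt; lra.
  - apply orbit_coeff_sum.
  - intros k. apply line_diffeo_mid.
    + apply (line_diffeo_comp P p (Nat.iter (S k) f)); [exact HP|].
      now apply line_diffeo_iter.
    + apply (line_diffeo_comp P p (Nat.iter k fi)); [exact HP|].
      now apply line_diffeo_iter. }
assert (He : forall x, sum_f_R0 (fun k => (rho ^ 2) ^ k / orbit_weight N *
    ((p (Nat.iter (S k) f x) * iter_deriv f df (S k) x +
     p (Nat.iter k fi x) * iter_deriv fi dfi k x) / 2)) N =
  orbit_sum f df fi dfi p rho N x * / (2 * orbit_weight N)).
{ intros x. unfold orbit_sum. rewrite <- sum_same. apply sum_eq. intros k _.
  field. lra. }
destruct H as (H1 & H2 & H3 & H4). split; [|split; [|split]].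
- intros x. rewrite <- He. apply H1.
- intros x. eapply continuity_pt_ext; [exact He|apply H2].
- intros x. rewrite <- He. apply H3.
- intros x Hx. rewrite <- He. now apply H4.
Qed.

Lemma orbit_average_fix P N x : f x = x -> P x = x -> orbit_average P N x = x.
Proof.
intros Hx HP. assert (Hxi : fi x = x) by (rewrite <- Hx at 1; apply Hfif).
unfold orbit_average.
rewrite (sum_eq _ (fun k => (rho ^ 2) ^ k / orbit_weight N * x)).
- rewrite sum_same, orbit_coeff_sum; ring.
- intros k _. rewrite 2!iter_fix by assumption. rewrite HP.
  f_equal. field.
Qed.

Lemma orbit_sum_jcont (p : R -> R -> R) N : jointly_continuous p ->
  jointly_continuous (fun s x => orbit_sum f df fi dfi (p s) rho N x).
Proof.
intros Hp. unfold orbit_sum.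
apply (jcont_sum (fun k s x => (rho ^ 2) ^ k *
    (p s (Nat.iter (S k) f x) * iter_deriv f df (S k) x +
     p s (Nat.iter k fi x) * iter_deriv fi dfi k x))).
assert (Haux : forall g dg k, line_diffeo g dg ->
  jointly_continuous (fun s x => p s (Nat.iter k g x) * iter_deriv g dg k x)).
{ intros g dg k Hg. assert (Hk := line_diffeo_iter g dg k Hg).
  apply jcont_mult.
  - apply (jcont_comp p (fun _ x => Nat.iter k g x) Hp).
    apply jcont_snd. intros x; eapply line_diffeo_cont; eauto.
  - apply jcont_snd, Hk. }
intros k. apply jcont_mult; [apply jcont_const|].
apply jcont_plus; now apply Haux.
Qed.

End OrbitSum.

(** * Components of the complement of the fixed point set *)

Lemma last_zero (phi : R -> R) z A : (forall x, continuity_pt phi x) ->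
  phi z = 0 -> z <= A ->
  exists a, z <= a <= A /\ phi a = 0 /\ forall x, a < x <= A -> phi x <> 0.
Proof.
intros Hc Hz HzA.
destruct (completeness (fun x => z <= x <= A /\ phi x = 0)) as [a [Hub Hlub]].
- exists A. intros x [Hx _]; lra.
- exists z; split; [lra|exact Hz].
- exists a. assert (za : z <= a) by (apply Hub; split; [lra|exact Hz]).
  assert (aA : a <= A) by (apply Hlub; intros x [Hx _]; lra).
  split; [lra|split].
  + destruct (Req_dec (phi a) 0) as [|Hne]; [assumption|exfalso].
    destruct (Hc a (Rabs (phi a))) as [d [Hd H]]; [now apply Rabs_pos_lt|].
    assert (a <= a - d); [|lra].
    apply Hlub. intros x [Hx Hx0].
    assert (x <= a) by (apply Hub; now split).
    destruct (Rle_lt_dec x (a - d)) as [|Hlt]; [assumption|exfalso].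
    destruct (Req_dec x a) as [->|Hxa]; [contradiction|].
    specialize (H x). simpl in H. unfold Rdist in H. rewrite Hx0 in H.
    unfold Rminus in H at 2. rewrite Rplus_0_l, Rabs_Ropp in H.
    apply (Rlt_irrefl (Rabs (phi a))), H.
    split; [split; [exact I|congruence]|apply Rabs_def1; lra].
  + intros x Hx H0. assert (x <= a) by (apply Hub; split; [lra|exact H0]). lra.
Qed.

Lemma fixed_point_free_component f df A : line_diffeo f df -> f A <> A ->
  exists a b, 0 <= a < A /\ A < b <= 1 /\ f a = a /\ f b = b /\
    forall x, a < x < b -> f x <> x.
Proof.
intros Hf HA.
assert (H01 : 0 < A < 1).
{ destruct (classic (0 < A < 1)) as [|H]; [assumption|].
  elim HA. now apply (line_diffeo_out f df). }
assert (Hc : forall x, continuity_pt f x) by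
  (intros; eapply line_diffeo_cont; eauto).
destruct (last_zero (fun x => f x - x) 0 A) as [a [Ha1 [Ha2 Ha3]]].
- intros x. apply (continuity_pt_minus f (fun x => x)); [apply Hc|].
  apply derivable_continuous_pt, derivable_pt_id.
- rewrite (line_diffeo_0 f df Hf); ring.
- lra.
(* The first fixed point to the right of [A] is a last zero after the reflection [x -> - x]. *)
- destruct (last_zero (fun x => f (- x) + x) (-1) (- A)) as [b [Hb1 [Hb2 Hb3]]].
  + intros x. apply (continuity_pt_plus (fun x => f (- x)) (fun x => x)).
    * apply (continuity_pt_comp (fun x => - x) f); [|apply Hc].
      apply (continuity_pt_opp (fun x => x)).
      apply derivable_continuous_pt, derivable_pt_id.
    * apply derivable_continuous_pt, derivable_pt_id.
  + replace (- -1) with 1 by lra. rewrite (line_diffeo_1 f df Hf); ring.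
  + lra.
  + exists a, (- b).
    assert (a <> A) by (intros ->; lra).
    assert (b <> - A) by (intros ->; rewrite Ropp_involutive in Hb2; lra).
    repeat split; try lra.
    intros x Hx Hfx. destruct (Rle_lt_dec x A) as [Hle|Hlt].
    * apply (Ha3 x); lra.
    * apply (Hb3 (- x)); [lra|]. rewrite Ropp_involutive; lra.
Qed.

(** * Clamping *)

Definition clamp (x : R) : R := Rmax 0 (Rmin 1 x).

Ltac clamp_cases := unfold clamp, Rmax, Rmin, Rabs;
  repeat (match goal with |- context [Rle_dec 1 ?v] => destruct (Rle_dec 1 v) end);
  repeat (match goal with |- context [Rle_dec 0 ?v] => destruct (Rle_dec 0 v) end);
  repeat (match goal with |- context [Rcase_abs ?u] => destruct (Rcase_abs u) end);
  lra.

Lemma clamp_I01 x : 0 <= clamp x <= 1.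
Proof. clamp_cases. Qed.

Lemma clamp_id x : 0 <= x <= 1 -> clamp x = x.
Proof. intros; clamp_cases. Qed.

Lemma clamp_le0 x : x <= 0 -> clamp x = 0.
Proof. intros; clamp_cases. Qed.

Lemma clamp_ge1 x : 1 <= x -> clamp x = 1.
Proof. intros; clamp_cases. Qed.

Lemma clamp_mono x y : x <= y -> clamp x <= clamp y.
Proof. intros; clamp_cases. Qed.

Lemma clamp_contract x y : Rabs (clamp x - clamp y) <= Rabs (x - y).
Proof. clamp_cases. Qed.

Lemma clamp_cont x : continuity_pt clamp x.
Proof.
intros eps Heps. exists eps; split; [exact Heps|]. intros y [_ Hy].
simpl in *. unfold Rdist in *. eapply Rle_lt_trans; [apply clamp_contract|exact Hy].
Qed.

(** At its corners [clamp] still has slopes of size at most 1, and there they multiply a factor that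
    tends to 0. *)
Lemma is_derive_clamp (phi dphi : R -> R) x :
  (forall y, is_derive phi y (dphi y)) -> dphi 0 = 0 -> dphi 1 = 0 ->
  is_derive (fun y => phi (clamp y)) x (dphi (clamp x)).
Proof.
intros Hphi H0 H1. destruct (classic (0 < x < 1)) as [Hx|Hx].
- apply is_derive_ext_loc with phi.
  + assert (Hd : 0 < Rmin x (1 - x)) by (apply Rmin_glb_lt; lra).
    exists (mkposreal _ Hd). intros y Hy.
    change (Rabs (y - x) < Rmin x (1 - x)) in Hy.
    assert (Ha := Rlt_le_trans _ _ _ Hy (Rmin_l _ _)).
    assert (Hb := Rlt_le_trans _ _ _ Hy (Rmin_r _ _)).
    apply Rabs_def2 in Ha, Hb. rewrite clamp_id; [reflexivity|lra].
  + rewrite clamp_id by lra. apply Hphi.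
- assert (Hz : dphi (clamp x) = 0).
  { destruct (Rle_lt_dec x 0); [rewrite clamp_le0|rewrite clamp_ge1]; lra. }
  destruct (is_derive_slope phi (clamp x) _ (Hphi _)) as [p [Hp [Hpc Hpe]]].
  set (q := fun y => p (clamp y) *
    (if Req_EM_T y x then 0 else (clamp y - clamp x) / (y - x))).
  assert (Hq : q x = dphi (clamp x)).
  { unfold q. rewrite Hp, Hz; ring. }
  rewrite <- Hq. apply (slope_is_derive (fun y => phi (clamp y))).
  + intros eps Heps.
    destruct (continuity_pt_comp clamp p x (clamp_cont x) Hpc eps Heps)
      as [d [Hd H]].
    exists d; split; [exact Hd|]. intros y Hy. specialize (H y Hy).
    unfold comp in H. simpl in *. unfold Rdist in *.
    rewrite Hq, Hz, Rminus_0_r. rewrite Hp, Hz, Rminus_0_r in H.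
    apply Rle_lt_trans with (2 := H). unfold q. rewrite Rabs_mult.
    rewrite <- (Rmult_1_r (Rabs (p (clamp y)))) at 2.
    apply Rmult_le_compat_l; [apply Rabs_pos|].
    destruct (Req_EM_T y x) as [_|Hne]; [rewrite Rabs_R0; lra|].
    assert (0 < Rabs (y - x)) by (apply Rabs_pos_lt; lra).
    rewrite Rabs_div by lra.
    apply Rmult_le_reg_r with (Rabs (y - x)); [assumption|].
    replace (Rabs (clamp y - clamp x) / Rabs (y - x) * Rabs (y - x)) with
      (Rabs (clamp y - clamp x)) by (field; lra).
    rewrite Rmult_1_l. apply clamp_contract.
  + intros y. rewrite Hpe. unfold q.
    destruct (Req_EM_T y x) as [->|Hne]; [ring|field; lra].
Qed.

(** * Dominated sums *)

(** Tannery's theorem, uniform in the parameter [x] and in the length [N]: the geometric bound makes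
    the tail beyond some [m] small, and the finitely many terms before [m] become small with large
    [n]. *)
Lemma sum_uniformly_small {X : Type} (a : nat -> nat -> X -> R) (rho C : R) :
  0 < rho < 1 ->
  (forall k n x, (1 <= n)%nat -> a k n x <= C * rho ^ k) ->
  (forall k eps, 0 < eps -> exists n0, forall n x, (n0 <= n)%nat ->
    a k n x <= eps) ->
  forall eps, 0 < eps -> exists n0, (1 <= n0)%nat /\ forall n N x, (n0 <= n)%nat ->
    sum_f_R0 (fun k => a k n x) N <= eps.
Proof.
intros Hrho Ha Hsm eps Heps.
set (C' := Rmax C 1). assert (HC' : 0 < C') by
  (apply Rlt_le_trans with 1; [lra|apply Rmax_r]).
assert (Ha' : forall k n x, (1 <= n)%nat -> a k n x <= C' * rho ^ k).
{ intros k n x Hn. apply Rle_trans with (1 := Ha k n x Hn).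
  apply Rmult_le_compat_r; [apply pow_le; lra|apply Rmax_l]. }
assert (HA : 0 < C' / (1 - rho)) by (apply Rdiv_lt_0_compat; lra).
destruct (pow_lt_1_zero rho) with (y := eps / 2 / (C' / (1 - rho)))
  as [m Hm]; [rewrite Rabs_right; lra|apply Rdiv_lt_0_compat; lra|].
specialize (Hm m (Nat.le_refl _)).
rewrite Rabs_right in Hm by (apply Rle_ge, pow_le; lra).
assert (Hhead : forall j e, 0 < e -> exists n0, (1 <= n0)%nat /\ forall k n x,
  (k < j)%nat -> (n0 <= n)%nat -> a k n x <= e).
{ intros j e He. induction j as [|j [n1 [H1 IH]]].
  - exists 1%nat; split; [lia|]. intros; lia.
  - destruct (Hsm j e He) as [n2 H2].
    exists (max n1 n2); split; [lia|]. intros k n x Hk Hn.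
    destruct (Nat.eq_dec k j) as [->|Hkj]; [apply H2; lia|apply IH; lia]. }
assert (Hm1 : 0 < INR m + 1) by (generalize (pos_INR m); lra).
(* Division by [INR m + 1] because [m] may be 0. *)
destruct (Hhead m (eps / 2 / (INR m + 1))) as [n0 [Hn0 H0]];
  [apply Rdiv_lt_0_compat; lra|].
exists n0; split; [exact Hn0|]. intros n N x Hn.
set (e := eps / 2 / (INR m + 1)) in *.
assert (He0 : 0 < e) by (apply Rdiv_lt_0_compat; lra).
assert (Hind : ((N < m)%nat -> sum_f_R0 (fun k => a k n x) N <= INR (S N) * e) /\
  ((m <= N)%nat -> sum_f_R0 (fun k => a k n x) N <=
    INR m * e + C' * (rho ^ m - rho ^ S N) / (1 - rho))).
{ induction N as [|N [IH1 IH2]].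
  - split; intros HN.
    + simpl. rewrite Rmult_1_l. apply H0; lia.
    + assert (m = O) by lia. subst m. simpl.
      replace (0 * e + C' * (1 - rho * 1) / (1 - rho)) with C' by (field; lra).
      generalize (Ha' O n x); simpl. rewrite Rmult_1_r; intros H; apply H; lia.
  - rewrite tech5; split; intros HN.
    + rewrite S_INR. assert (H := IH1 ltac:(lia)).
      assert (a (S N) n x <= e) by (apply H0; lia). lra.
    + assert (Hs := Ha' (S N) n x ltac:(lia)).
      destruct (Nat.eq_dec m (S N)) as [Hm'|Hm'].
      * assert (H := IH1 ltac:(lia)). rewrite Hm' at 1.
        replace (C' * (rho ^ m - rho ^ S (S N)) / (1 - rho)) with
          (C' * rho ^ S N); [lra|]. rewrite Hm'; simpl; field; lra.
      * assert (H := IH2 ltac:(lia)).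
        replace (C' * (rho ^ m - rho ^ S (S N)) / (1 - rho)) with
          (C' * (rho ^ m - rho ^ S N) / (1 - rho) + C' * rho ^ S N); [lra|].
        simpl; field; lra. }
assert (Hme : (INR m + 1) * e = eps / 2) by (unfold e; field; lra).
destruct (Nat.lt_ge_cases N m) as [HN|HN].
- apply Rle_trans with (1 := proj1 Hind HN).
  assert (INR (S N) <= INR m) by (apply le_INR; lia).
  assert (INR (S N) * e <= INR m * e) by (apply Rmult_le_compat_r; lra). lra.
- apply Rle_trans with (1 := proj2 Hind HN).
  assert (C' * (rho ^ m - rho ^ S N) / (1 - rho) <= eps / 2).
  { apply Rle_trans with (C' / (1 - rho) * rho ^ m).
    - assert (0 < C' / (1 - rho) * rho ^ S N) by
        (apply Rmult_lt_0_compat; [exact HA|apply pow_lt; lra]).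
      unfold Rdiv in *; lra.
    - apply Rle_trans with (C' / (1 - rho) * (eps / 2 / (C' / (1 - rho)))).
      + apply Rmult_le_compat_l; lra.
      + right; field; split; lra. }
  lra.
Qed.

(** * Densities concentrated on two fundamental domains *)

Lemma is_derive_Rplus (F G : R -> R) (x d e : R) : is_derive F x d ->
  is_derive G x e -> is_derive (fun y => F y + G y) x (d + e).
Proof. exact (is_derive_plus F G x d e). Qed.

Lemma is_derive_Rmult_const (F : R -> R) (c x d : R) : is_derive F x d ->
  is_derive (fun y => c * F y) x (c * d).
Proof. exact (is_derive_scal F x c d). Qed.

Lemma is_derive_clamp_affine (phi dphi w : R -> R) (A L dw x : R) :
  (forall y, is_derive phi y (dphi y)) -> dphi 0 = 0 -> dphi 1 = 0 ->
  is_derive w x dw ->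
  is_derive (fun y => phi (clamp ((w y - A) / L))) x
    (dphi (clamp ((w x - A) / L)) * (dw / L)).
Proof.
intros Hphi H0 H1 Hw. rewrite Rmult_comm.
apply (is_derive_comp (fun v => phi (clamp v)) (fun y => (w y - A) / L)).
- now apply is_derive_clamp.
- apply is_derive_ext with (fun y => / L * (w y + - A)).
  + intros t; apply Rmult_comm.
  + replace (dw / L) with (/ L * (dw + 0)) by (unfold Rdiv; ring).
    apply (is_derive_scal (fun y => w y + - A)).
    apply (is_derive_plus w (fun _ => - A)); [exact Hw|].
    apply (is_derive_const (- A)).
Qed.

(** The primitive of [v^n + (1 - v)^n - 1] that vanishes at 0. Its value at 1 is [2 / (n + 1) - 1],
    a loss of mass that the bump makes up for. *)
Definition end_bump (n : nat) (v : R) : R :=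
  (v ^ S n - (1 - v) ^ S n + 1) / INR (S n) - v.

Lemma end_bump_derive n v :
  is_derive (end_bump n) v (v ^ n + (1 - v) ^ n - 1).
Proof.
unfold end_bump. assert (INR (S n) <> 0) by (apply not_0_INR; lia).
auto_derive; [exact I|].
change (match n with 0%nat => 1 | S _ => INR n + 1 end) with (INR (S n)).
unfold Rminus. field. assumption.
Qed.

Lemma smoothstep_derive v :
  is_derive (fun v => 3 * v ^ 2 - 2 * v ^ 3) v (6 * v * (1 - v)).
Proof. auto_derive; [exact I|ring]. Qed.

Section Bump.
Variables (f df fi dfi : R -> R) (A a b : R) (h dh : R -> R -> R).
Hypotheses (Hf : line_diffeo f df) (Hfi : line_diffeo fi dfi)
  (Hfif : forall x, fi (f x) = x) (Hffi : forall x, f (fi x) = x)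
  (HA : A < f A) (Ha : 0 <= a < A) (Hb : A < b <= 1)
  (Hfa : f a = a) (Hfb : f b = b)
  (Hnofix : forall x, a < x < b -> f x <> x)
  (Hh : forall s, line_diffeo (h s) (dh s))
  (Hsupp : forall s x, x <= A \/ f A <= x -> h s x = x /\ dh s x = 1)
  (Hhc : jointly_continuous h) (Hdhc : jointly_continuous dh).

Let B := f (f A).

(** [h_s] composed with [f h_s f^-1]. The first is supported in [J = [A, f A]], the second in [f J =
    [f A, B]], so the product acts as each of them on its own interval. *)
Definition shifted_twice (s x : R) : R := h s (f (h s (fi x))).
Definition shifted_twice_deriv (s x : R) : R :=
  dh s (f (h s (fi x))) * (df (h s (fi x)) * (dh s (fi x) * dfi x)).

Lemma shifted_twice_diffeo s :
  line_diffeo (shifted_twice s) (shifted_twice_deriv s).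
Proof.
apply (line_diffeo_comp (h s) (dh s) (fun x => f (h s (fi x)))
  (fun x => df (h s (fi x)) * (dh s (fi x) * dfi x))); [apply Hh|].
apply (line_diffeo_comp f df (fun x => h s (fi x))
  (fun x => dh s (fi x) * dfi x)); [exact Hf|].
apply (line_diffeo_comp (h s) (dh s) fi dfi); [apply Hh|exact Hfi].
Qed.

Lemma B_gt : f A < B.
Proof. now apply (line_diffeo_incr f df). Qed.

Lemma component_stable x : a < x < b -> a < f x < b.
Proof.
intros Hx. split; [rewrite <- Hfa|rewrite <- Hfb];
apply (line_diffeo_incr f df); tauto.
Qed.

Lemma component_stable_inv x : a < x < b -> a < fi x < b.
Proof.
intros Hx. split; apply (line_diffeo_lt_inv f df _ _ Hf); rewrite Hffi;
[rewrite Hfa|rewrite Hfb]; tauto.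
Qed.

Lemma component_stable_iter g k x : (forall x, a < x < b -> a < g x < b) ->
  a < x < b -> a < Nat.iter k g x < b.
Proof. intros Hg Hx; induction k as [|k IH]; simpl; auto. Qed.

Lemma fi_le x : x <= f A -> fi x <= A.
Proof. intros Hx. rewrite <- (Hfif A). now apply (line_diffeo_le fi dfi). Qed.

Lemma iter_f_ge k x : A <= x -> f A <= Nat.iter (S k) f x.
Proof.
intros Hx. induction k as [|k IH].
- now apply (line_diffeo_le f df).
- change (f A <= f (Nat.iter (S k) f x)). apply (line_diffeo_le f df); [tauto|lra].
Qed.

Lemma iter_fi_le k x : x <= f A -> Nat.iter (S k) fi x <= A.
Proof.
intros Hx. induction k as [|k IH].
- now apply fi_le.
- change (fi (Nat.iter (S k) fi x) <= A). apply fi_le; lra.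
Qed.

Lemma dfi_df_eq x : dfi (f x) * df x = 1.
Proof. now apply (dfi_df f df fi dfi). Qed.

Lemma df_dfi_eq x : df (fi x) * dfi x = 1.
Proof. now apply (dfi_df fi dfi f df). Qed.

Lemma shifted_twice_out s x : x <= A \/ B <= x -> shifted_twice s x = x.
Proof.
unfold shifted_twice. intros [Hx|Hx].
- assert (fi x <= A) by (apply fi_le; lra).
  rewrite (proj1 (Hsupp s (fi x) (or_introl H))), Hffi.
  apply Hsupp; now left.
- assert (f A <= fi x).
  { rewrite <- (Hfif (f A)). now apply (line_diffeo_le fi dfi). }
  rewrite (proj1 (Hsupp s (fi x) (or_intror H))), Hffi.
  apply Hsupp. right. generalize B_gt; lra.
Qed.

Lemma h_segment s x : A <= x <= f A -> A <= h s x <= f A.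
Proof.
intros Hx.
assert (E1 := line_diffeo_le (h s) (dh s) A x (Hh s) (proj1 Hx)).
assert (E2 := line_diffeo_le (h s) (dh s) x (f A) (Hh s) (proj2 Hx)).
rewrite (proj1 (Hsupp s A (or_introl (Rle_refl _)))) in E1.
rewrite (proj1 (Hsupp s (f A) (or_intror (Rle_refl _)))) in E2. now split.
Qed.

Lemma shifted_twice_J s x : A <= x <= f A ->
  shifted_twice s x = h s x /\ shifted_twice_deriv s x = dh s x.
Proof.
intros Hx. unfold shifted_twice, shifted_twice_deriv.
assert (fi x <= A) by (apply fi_le; tauto).
destruct (Hsupp s (fi x) (or_introl H)) as [-> ->].
rewrite Hffi, Rmult_1_l, df_dfi_eq. split; ring.
Qed.

Lemma shifted_twice_fJ s x : A <= x <= f A ->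
  shifted_twice s (f x) = f (h s x) /\
  shifted_twice_deriv s (f x) * df x = df (h s x) * dh s x.
Proof.
intros Hx. unfold shifted_twice, shifted_twice_deriv. rewrite Hfif.
assert (f A <= f (h s x)).
{ apply (line_diffeo_le f df); [tauto|]. now apply h_segment. }
destruct (Hsupp s (f (h s x)) (or_intror H)) as [-> ->].
split; [reflexivity|].
transitivity (df (h s x) * dh s x * (dfi (f x) * df x)); [ring|].
rewrite dfi_df_eq; ring.
Qed.

(** The derivative of the smoothstep [3 v^2 - 2 v^3] in the coordinate [v] of [[A, B]]; the factor
    [1 / (B - A)] is left to [concentrated_deriv]. The middle point [f A] lies inside, where the
    bump is positive. *)
Definition bump_density (y : R) : R :=
  6 * clamp ((y - A) / (B - A)) * (1 - clamp ((y - A) / (B - A))).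

Lemma bump_density_out y : y <= A \/ B <= y -> bump_density y = 0.
Proof.
assert (HB := B_gt). assert (0 < / (B - A)) by (apply Rinv_0_lt_compat; lra).
intros [Hy|Hy]; unfold bump_density.
- rewrite clamp_le0; [ring|]. unfold Rdiv; nra.
- rewrite clamp_ge1; [ring|].
  apply Rmult_le_reg_r with (B - A); [lra|]. field_simplify; lra.
Qed.

Lemma bump_density_nonneg y : 0 <= bump_density y.
Proof.
unfold bump_density. generalize (clamp_I01 ((y - A) / (B - A))). nra.
Qed.

Lemma bump_density_pos y : A < y < B -> 0 < bump_density y.
Proof.
intros Hy. unfold bump_density.
assert (0 < (y - A) / (B - A)) by (apply Rdiv_lt_0_compat; lra).
assert ((y - A) / (B - A) < 1).
{ apply Rmult_lt_reg_r with (B - A); [lra|]. field_simplify; lra. }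
rewrite clamp_id by lra. nra.
Qed.

Lemma continuity_clamp_affine u L x : continuity_pt (fun y => clamp ((y - u) / L)) x.
Proof.
apply (continuity_pt_comp (fun y => (y - u) / L) clamp); [|apply clamp_cont].
apply derivable_continuous_pt. apply derivable_pt_mult; [|apply derivable_pt_const].
apply derivable_pt_minus; [apply derivable_pt_id|apply derivable_pt_const].
Qed.

Lemma bump_density_cont y : continuity_pt bump_density y.
Proof.
unfold bump_density.
apply (continuity_pt_comp (fun y => clamp ((y - A) / (B - A)))
  (fun v => 6 * v * (1 - v))); [apply continuity_clamp_affine|].
apply derivable_continuous_pt. reg.
Qed.

(* The density on the fundamental domain obtained by adding up the bump over
   the two consecutive domains that carry it; unlike the bump itself it is
   bounded below. *)
Definition folded_density (y : R) : R :=
  bump_density y + bump_density (f y) * df y.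

Lemma folded_density_pos y : A <= y <= f A -> 0 < folded_density y.
Proof.
intros Hy. unfold folded_density. assert (HB := B_gt).
assert (Hd : 0 < df y) by apply Hf.
assert (H1 := bump_density_nonneg y). assert (H2 := bump_density_nonneg (f y)).
destruct (proj1 Hy) as [Hlt| <-].
- assert (0 < bump_density y) by (apply bump_density_pos; lra).
  assert (0 <= bump_density (f y) * df y) by (apply Rmult_le_pos; lra). lra.
- assert (0 < bump_density (f A)) by (apply bump_density_pos; lra).
  assert (0 < bump_density (f A) * df A) by (apply Rmult_lt_0_compat; lra). lra.
Qed.

Lemma folded_density_cont y : continuity_pt folded_density y.
Proof.
apply (continuity_pt_plus bump_density (fun y => bump_density (f y) * df y));
  [apply bump_density_cont|].
apply (continuity_pt_mult (fun y => bump_density (f y)) df); [|apply Hf].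
apply (continuity_pt_comp f bump_density); [|apply bump_density_cont].
eapply line_diffeo_cont; eauto.
Qed.

(** For large [n] it is small inside [(a, b)], yet for [n >= 1] it equals 1 at both ends and beyond,
    as the density of the identity does. *)
Definition end_density (n : nat) (x : R) : R :=
  clamp ((x - a) / (b - a)) ^ n + (1 - clamp ((x - a) / (b - a))) ^ n.

(** The mass that remains for the bump: [v^n + (1 - v)^n] has integral [2 / (n + 1)] over the unit
    interval. *)
Definition bump_height (n : nat) : R := (b - a) * (1 - 2 / INR (S n)).

Definition concentrated (n : nat) (s x : R) : R :=
  x + (b - a) * end_bump n (clamp ((x - a) / (b - a))) +
  bump_height n * (fun v => 3 * v ^ 2 - 2 * v ^ 3)
    (clamp ((shifted_twice s x - A) / (B - A))).

Definition concentrated_deriv (n : nat) (s x : R) : R :=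
  end_density n x + bump_height n / (B - A) *
    (bump_density (shifted_twice s x) * shifted_twice_deriv s x).

Lemma end_density_pos n x : 0 < end_density n x.
Proof.
unfold end_density. set (v := clamp _).
assert (0 <= v <= 1) by apply clamp_I01.
assert (0 <= v ^ n) by (apply pow_le; lra).
assert (0 <= (1 - v) ^ n) by (apply pow_le; lra).
destruct (Rlt_le_dec 0 v).
- assert (0 < v ^ n) by (now apply pow_lt); lra.
- assert (0 < (1 - v) ^ n) by (apply pow_lt; lra); lra.
Qed.

Lemma end_density_le1 n x : (1 <= n)%nat -> end_density n x <= 1.
Proof.
intros Hn. unfold end_density. set (v := clamp _).
assert (0 <= v <= 1) by apply clamp_I01.
assert (v ^ n <= v ^ 1) by (apply pow_le_pow_small; [lra|lia]).
assert ((1 - v) ^ n <= (1 - v) ^ 1) by (apply pow_le_pow_small; [lra|lia]).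
simpl in *; lra.
Qed.

Lemma end_density_cont n x : continuity_pt (end_density n) x.
Proof.
unfold end_density.
apply (continuity_pt_comp (fun y => clamp ((y - a) / (b - a)))
  (fun v => v ^ n + (1 - v) ^ n)); [apply continuity_clamp_affine|].
apply derivable_continuous_pt. reg.
Qed.

Lemma bump_height_pos n : (2 <= n)%nat -> (b - a) / 3 <= bump_height n.
Proof.
intros Hn. unfold bump_height. unfold Rdiv at 1.
apply Rmult_le_compat_l; [lra|].
assert (3 <= INR (S n)).
{ replace 3 with (INR 3) by (simpl; lra). apply le_INR; lia. }
assert (2 / INR (S n) <= 2 / 3); [|lra].
apply Rmult_le_compat_l; [lra|]. apply Rinv_le_contravar; lra.
Qed.

(** To the left of [a] both corrections to the identity vanish; to the right of [b] they cancel, by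
    the choice of [bump_height]. *)
Lemma outside_component n s x : (1 <= n)%nat -> x <= a \/ b <= x ->
  concentrated n s x = x /\ concentrated_deriv n s x = 1.
Proof.
intros Hn Hx. assert (HB := B_gt).
assert (HBb : B < b).
{ apply component_stable, component_stable; lra. }
assert (H0 : 0 ^ n = 0) by (apply pow_i; lia).
assert (HS0 : 0 ^ S n = 0) by (apply pow_i; lia).
assert (0 < b - a) by lra.
assert (HSn : INR (S n) <> 0) by (apply not_0_INR; lia).
unfold concentrated, concentrated_deriv, end_density, bump_height, end_bump.
destruct Hx as [Hx|Hx].
- rewrite shifted_twice_out by (left; lra).
  rewrite bump_density_out by (left; lra).
  rewrite (clamp_le0 ((x - a) / (b - a))).
  + rewrite (clamp_le0 ((x - A) / (B - A))).
    * replace (1 - 0) with 1 by ring. rewrite ?pow1, HS0, H0.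
      split; [field; assumption|ring].
    * assert (0 < / (B - A)) by (apply Rinv_0_lt_compat; lra). unfold Rdiv; nra.
  + assert (0 < / (b - a)) by (apply Rinv_0_lt_compat; lra). unfold Rdiv; nra.
- rewrite shifted_twice_out by (right; lra).
  rewrite bump_density_out by (right; lra).
  rewrite (clamp_ge1 ((x - a) / (b - a))).
  + rewrite (clamp_ge1 ((x - A) / (B - A))).
    * replace (1 - 1) with 0 by ring. rewrite ?pow1, HS0, H0.
      split; [field; assumption|ring].
    * apply Rmult_le_reg_r with (B - A); [lra|]. field_simplify; lra.
  + apply Rmult_le_reg_r with (b - a); [lra|]. field_simplify; lra.
Qed.

Lemma concentrated_deriv_pos n s x : (2 <= n)%nat -> 0 < concentrated_deriv n s x.
Proof.
intros Hn. unfold concentrated_deriv. assert (HB := B_gt).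
assert (H1 := end_density_pos n x). assert (H2 := bump_height_pos n Hn).
assert (0 <= bump_height n / (B - A)) by (apply Rdiv_le_0_compat; lra).
assert (0 < shifted_twice_deriv s x) by apply shifted_twice_diffeo.
assert (H3 := bump_density_nonneg (shifted_twice s x)).
assert (0 <= bump_height n / (B - A) *
  (bump_density (shifted_twice s x) * shifted_twice_deriv s x)); [|lra].
apply Rmult_le_pos; [assumption|]. apply Rmult_le_pos; lra.
Qed.

Lemma concentrated_deriv_jcont n : jointly_continuous (concentrated_deriv n).
Proof.
assert (Hfic : forall x, continuity_pt fi x) by
  (intros; eapply line_diffeo_cont; eauto).
assert (Hfc : forall x, continuity_pt f x) by
  (intros; eapply line_diffeo_cont; eauto).
assert (J1 : jointly_continuous (fun s x => h s (fi x))).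
{ apply (jcont_comp h (fun _ x => fi x)); [assumption|now apply jcont_snd]. }
assert (J2 : jointly_continuous (fun s x => f (h s (fi x)))).
{ apply (jcont_comp (fun _ x => f x)); [now apply jcont_snd|assumption]. }
unfold concentrated_deriv. apply jcont_plus.
- apply jcont_snd, end_density_cont.
- apply jcont_mult; [apply jcont_const|]. apply jcont_mult.
  + apply (jcont_comp (fun _ y => bump_density y) shifted_twice).
    * apply jcont_snd, bump_density_cont.
    * apply (jcont_comp h (fun s x => f (h s (fi x)))); assumption.
  + unfold shifted_twice_deriv. apply jcont_mult.
    * apply (jcont_comp dh (fun s x => f (h s (fi x)))); assumption.
    * apply jcont_mult; [|apply jcont_mult].
      -- apply (jcont_comp (fun _ x => df x) (fun s x => h s (fi x)));
           [apply jcont_snd, Hf|assumption].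
      -- apply (jcont_comp dh (fun _ x => fi x)); [assumption|now apply jcont_snd].
      -- apply jcont_snd, Hfi.
Qed.

Lemma concentrated_diffeo n s : (2 <= n)%nat ->
  line_diffeo (concentrated n s) (concentrated_deriv n s).
Proof.
intros Hn. assert (HB := B_gt). split; [|split; [|split]].
- intros x. unfold concentrated.
  replace (concentrated_deriv n s x) with
    ((1 + (b - a) * ((clamp ((x - a) / (b - a)) ^ n +
       (1 - clamp ((x - a) / (b - a))) ^ n - 1) * (1 / (b - a)))) +
     bump_height n * (6 * clamp ((shifted_twice s x - A) / (B - A)) *
       (1 - clamp ((shifted_twice s x - A) / (B - A))) *
       (shifted_twice_deriv s x / (B - A)))).
  2:{ unfold concentrated_deriv, end_density, bump_density. field. lra. }
  apply is_derive_Rplus.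
  + apply is_derive_Rplus; [apply (is_derive_id x)|].
    apply is_derive_Rmult_const.
    apply (is_derive_clamp_affine (end_bump n) (fun v => v ^ n + (1 - v) ^ n - 1)
      (fun x => x)).
    * apply end_bump_derive.
    * rewrite pow_i by lia. rewrite Rminus_0_r, pow1; ring.
    * replace (1 - 1) with 0 by ring. rewrite pow_i by lia. rewrite pow1; ring.
    * apply (is_derive_id x).
  + apply is_derive_Rmult_const.
    apply (is_derive_clamp_affine (fun v => 3 * v ^ 2 - 2 * v ^ 3)
      (fun v => 6 * v * (1 - v))); try ring.
    * apply smoothstep_derive.
    * apply shifted_twice_diffeo.
- intros x. apply jcont_section, concentrated_deriv_jcont.
- intros x. now apply concentrated_deriv_pos.
- intros x Hx. apply outside_component; [lia|lra].
Qed.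

Lemma concentrated_fix n s x : (1 <= n)%nat -> f x = x -> concentrated n s x = x.
Proof.
intros Hn Hx. apply outside_component; [exact Hn|].
destruct (Rle_lt_dec x a) as [|H1]; [tauto|].
destruct (Rle_lt_dec b x) as [|H2]; [tauto|].
now elim (Hnofix x (conj H1 H2)).
Qed.

(** From the orbit of a point of [J], only the point and its image by [f] can lie in [(A, B)]. Hence
    just the two terms with [k = 0] survive, whatever [rho] and [N] are. *)
Lemma orbit_sum_bump rho N s x : A <= x <= f A ->
  orbit_sum f df fi dfi
    (fun y => bump_density (shifted_twice s y) * shifted_twice_deriv s y) rho N x =
  folded_density (h s x) * dh s x.
Proof.
intros Hx. unfold orbit_sum.
assert (H0 : forall y, y <= A \/ B <= y ->
  bump_density (shifted_twice s y) * shifted_twice_deriv s y = 0).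
{ intros y Hy. rewrite shifted_twice_out, bump_density_out by assumption. ring. }
assert (H1 : forall k, Nat.iter (S k) fi x <= A).
{ intros k; apply iter_fi_le; tauto. }
assert (H2 : forall k, B <= Nat.iter (S (S k)) f x).
{ intros k. apply (line_diffeo_le f df); [exact Hf|]. now apply iter_f_ge. }
induction N as [|N IH].
- simpl. destruct (shifted_twice_J s x Hx) as [-> ->].
  destruct (shifted_twice_fJ s x Hx) as [-> Hd].
  unfold folded_density.
  transitivity (bump_density (f (h s x)) *
    (shifted_twice_deriv s (f x) * df x) + bump_density (h s x) * dh s x);
    [ring|rewrite Hd; ring].
- rewrite tech5, IH. rewrite (H0 (Nat.iter (S N) fi x)) by (left; apply H1).
  rewrite (H0 (Nat.iter (S (S N)) f x)) by (right; apply H2). ring.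
Qed.

Lemma end_density_small y1 y2 eps : a < y1 -> y2 < b -> 0 < eps ->
  exists n0, forall n y, (n0 <= n)%nat -> y1 <= y <= y2 ->
    end_density n y <= eps.
Proof.
intros H1 H2 He.
set (u := fun y => (y - a) / (b - a)).
assert (Hi : 0 < / (b - a)) by (apply Rinv_0_lt_compat; lra).
assert (Hu : forall y, u y * (b - a) = y - a) by (intros; unfold u; field; lra).
assert (Hpow : forall v, v < 1 -> exists n0, forall n w, (n0 <= n)%nat ->
  0 <= w <= v -> w ^ n <= eps / 2).
{ intros v Hv. destruct (Rle_lt_dec 0 v) as [Hv0|Hv0].
  - destruct (pow_lt_1_zero v) with (y := eps / 2) as [n0 Hn0];
      [rewrite Rabs_right; lra|lra|].
    exists n0. intros n w Hn Hw. specialize (Hn0 n Hn).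
    rewrite Rabs_right in Hn0 by (apply Rle_ge, pow_le; lra).
    apply Rle_trans with (v ^ n); [now apply pow_incr|lra].
  - exists O. intros n w _ Hw; lra. }
destruct (Hpow (u y2)) as [n1 Hn1].
{ apply Rmult_lt_reg_r with (b - a); [lra|]. rewrite Hu; lra. }
destruct (Hpow (1 - u y1)) as [n2 Hn2].
{ enough (0 < u y1) by lra. apply Rmult_lt_0_compat; lra. }
exists (max n1 n2). intros n y Hn Hy. unfold end_density.
destruct (Rle_lt_dec y1 y2) as [H12|H12]; [|lra].
assert (M1 : u y1 <= u y) by (apply Rmult_le_compat_r; lra).
assert (M2 : u y <= u y2) by (apply Rmult_le_compat_r; lra).
assert (0 < u y1) by (apply Rmult_lt_0_compat; lra).
assert (u y2 < 1).
{ apply Rmult_lt_reg_r with (b - a); [lra|]. rewrite Hu; lra. }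
fold (u y). rewrite clamp_id by lra.
assert (u y ^ n <= eps / 2) by (apply Hn1; [lia|lra]).
assert ((1 - u y) ^ n <= eps / 2) by (apply Hn2; [lia|lra]).
lra.
Qed.

(** * Choice of the parameters for a given error and range of times *)

Hypothesis Hfix : forall x, f x = x -> df x = 1.

Lemma two_sided_growth rho : 0 < rho < 1 -> exists C, 0 < C /\
  (forall k x, iter_deriv f df k x * rho ^ k <= C) /\
  (forall k x, iter_deriv fi dfi k x * rho ^ k <= C).
Proof.
intros Hrho.
assert (Hg : 1 < / rho) by (rewrite <- Rinv_1; apply Rinv_lt_contravar; lra).
destruct (iter_deriv_growth f df (/ rho) Hf Hfix Hg) as [C1 [HC1 H1]].
destruct (iter_deriv_growth fi dfi (/ rho) Hfi) as [C2 [HC2 H2]].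
- intros x Hx. assert (Hfx : f x = x) by (rewrite <- Hx at 1; apply Hffi).
  generalize (dfi_df_eq x). rewrite Hfx, (Hfix x Hfx). lra.
- exact Hg.
- exists (C1 + C2).
  assert (Hr : forall C k y, y <= C * (/ rho) ^ k -> y * rho ^ k <= C).
  { intros C k y Hy. assert (0 < rho ^ k) by (apply pow_lt; lra).
    rewrite pow_inv in Hy.
    replace C with (C * / rho ^ k * rho ^ k) by (field; lra).
    apply Rmult_le_compat_r; lra. }
  split; [lra|split]; intros k x.
  + apply Rle_trans with C1; [now apply Hr|lra].
  + apply Rle_trans with C2; [now apply Hr|lra].
Qed.

(** Dominated convergence in [n]: derivatives of iterates grow at most like [C rho^-k], which leaves
    [rho^k] of the weight, and for fixed [k] the images of [J] lie in a compact part of [(a, b)],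
    where the end densities tend to 0. *)
Lemma orbit_sum_end_density_small rho eps : 0 < rho < 1 -> 0 < eps ->
  exists n0, (1 <= n0)%nat /\ forall n N x, (n0 <= n)%nat -> A <= x <= f A ->
    orbit_sum f df fi dfi (end_density n) rho N x <= eps.
Proof.
intros Hrho Heps.
destruct (two_sided_growth rho Hrho) as [C [HC [HC1 HC2]]].
assert (Hpk : forall k, 0 < rho ^ k) by (intros; apply pow_lt; lra).
assert (HfA : a < f A < b) by (apply component_stable; lra).
assert (Hp1 : forall k x, 0 < iter_deriv f df k x) by
  (intros; now apply (iter_deriv_pos f df)).
assert (Hp2 : forall k x, 0 < iter_deriv fi dfi k x) by
  (intros; now apply (iter_deriv_pos fi dfi)).
(* Membership in the fundamental domain becomes part of the type of the parameter. *)
set (J := {x : R | A <= x <= f A}).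
destruct (sum_uniformly_small (fun k n (x : J) => (rho ^ 2) ^ k *
    (end_density n (Nat.iter (S k) f (proj1_sig x)) *
       iter_deriv f df (S k) (proj1_sig x) +
     end_density n (Nat.iter k fi (proj1_sig x)) *
       iter_deriv fi dfi k (proj1_sig x))) rho (C / rho + C) Hrho)
  with (eps := eps) as [n0 [Hn0 H0]].
- intros k n [x Hx] Hn; simpl proj1_sig.
  assert (E1 : end_density n (Nat.iter (S k) f x) * iter_deriv f df (S k) x <=
    C * / rho ^ S k).
  { apply Rle_trans with (1 * iter_deriv f df (S k) x).
    - apply Rmult_le_compat_r; [left; apply Hp1|now apply end_density_le1].
    - rewrite Rmult_1_l. generalize (HC1 (S k) x). intros H.
      replace (iter_deriv f df (S k) x) with
        (iter_deriv f df (S k) x * rho ^ S k * / rho ^ S k)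
        by (field; apply Rgt_not_eq, Hpk).
      apply Rmult_le_compat_r; [left; apply Rinv_0_lt_compat, Hpk|exact H]. }
  assert (E2 : end_density n (Nat.iter k fi x) * iter_deriv fi dfi k x <=
    C * / rho ^ k).
  { apply Rle_trans with (1 * iter_deriv fi dfi k x).
    - apply Rmult_le_compat_r; [left; apply Hp2|now apply end_density_le1].
    - rewrite Rmult_1_l. generalize (HC2 k x). intros H.
      replace (iter_deriv fi dfi k x) with
        (iter_deriv fi dfi k x * rho ^ k * / rho ^ k)
        by (field; apply Rgt_not_eq, Hpk).
      apply Rmult_le_compat_r; [left; apply Rinv_0_lt_compat, Hpk|exact H]. }
  replace ((C / rho + C) * rho ^ k) with
    ((rho ^ 2) ^ k * (C * / rho ^ S k + C * / rho ^ k)).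
  + apply Rmult_le_compat_l; [left; apply pow_lt, pow_lt; lra|lra].
  + rewrite <- pow_mult, Nat.mul_comm, pow_mult. simpl. field.
    generalize (Hpk k); lra.
- intros k e He.
  set (L := C * / rho ^ S k + C * / rho ^ k + 1).
  assert (HL1 : 0 < C * / rho ^ S k) by
    (apply Rmult_lt_0_compat; [lra|apply Rinv_0_lt_compat, Hpk]).
  assert (HL2 : 0 < C * / rho ^ k) by
    (apply Rmult_lt_0_compat; [lra|apply Rinv_0_lt_compat, Hpk]).
  assert (HL : 0 < L) by (unfold L; lra).
  set (e' := e / 2 / L).
  assert (He' : 0 < e') by (unfold e'; apply Rdiv_lt_0_compat; lra).
  assert (Hin : forall g dg j, (forall x, a < x < b -> a < g x < b) ->
    line_diffeo g dg -> exists n1, forall n x, (n1 <= n)%nat -> A <= x <= f A ->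
      end_density n (Nat.iter j g x) <= e').
  { intros g dg j Hg Hgd. assert (Hit := line_diffeo_iter g dg j Hgd).
    destruct (component_stable_iter g j A Hg) as [B1 _]; [lra|].
    destruct (component_stable_iter g j (f A) Hg HfA) as [_ B2].
    destruct (end_density_small _ _ e' B1 B2 He') as [n1 Hn1].
    exists n1. intros n x Hn [Hx1 Hx2]. apply Hn1; [exact Hn|].
    split; now apply (line_diffeo_le _ _ _ _ Hit). }
  destruct (Hin f df (S k) component_stable Hf) as [n1 H1].
  destruct (Hin fi dfi k component_stable_inv Hfi) as [n2 H2].
  exists (max n1 n2). intros n [x Hx] Hn; simpl proj1_sig.
  specialize (H1 n x ltac:(lia) Hx). specialize (H2 n x ltac:(lia) Hx).
  assert (D1 : iter_deriv f df (S k) x <= L).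
  { apply Rle_trans with (C * / rho ^ S k); [|unfold L; lra].
    apply Rmult_le_reg_r with (rho ^ S k); [apply Hpk|].
    rewrite Rmult_assoc, Rinv_l, Rmult_1_r by apply Rgt_not_eq, Hpk. apply HC1. }
  assert (D2 : iter_deriv fi dfi k x <= L).
  { apply Rle_trans with (C * / rho ^ k); [|unfold L; lra].
    apply Rmult_le_reg_r with (rho ^ k); [apply Hpk|].
    rewrite Rmult_assoc, Rinv_l, Rmult_1_r by apply Rgt_not_eq, Hpk. apply HC2. }
  assert (Hw : 0 <= (rho ^ 2) ^ k <= 1).
  { split; [apply pow_le, pow_le; lra|]. rewrite <- pow_mult.
    rewrite <- (pow1 (2 * k)). apply pow_incr; lra. }
  apply Rle_trans with (1 * (e' * L + e' * L)).
  + assert (0 <= end_density n (Nat.iter (S k) f x) * iter_deriv f df (S k) x).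
    { apply Rmult_le_pos; left; [apply end_density_pos|apply Hp1]. }
    assert (0 <= end_density n (Nat.iter k fi x) * iter_deriv fi dfi k x).
    { apply Rmult_le_pos; left; [apply end_density_pos|apply Hp2]. }
    apply Rmult_le_compat; [tauto|lra|tauto|].
    apply Rplus_le_compat; apply Rmult_le_compat; try assumption; left;
      apply end_density_pos || apply Hp1 || apply Hp2.
  + right. unfold e'. field. lra.
- exact Heps.
- exists n0; split; [exact Hn0|]. intros n N x Hn Hx.
  exact (H0 n N (exist _ x Hx) Hn).
Qed.

(* The parameters are chosen in the order [rho], [n], [N]: averaging gives
   near invariance, then the bump must dominate the end densities on the
   fundamental domain for all averaging lengths, and finally the averaging must
   be long enough for the boundary terms to be negligible. *)
Lemma good_family T eta : 0 < eta -> exists (E e : R -> R -> R) (c : R),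
  0 < c /\ (forall s, line_diffeo (E s) (e s)) /\
  (forall s x, f x = x -> E s x = x) /\ jointly_continuous e /\
  (forall s x, 0 <= s <= T -> Rabs (e s (f x) * df x - e s x) <= eta * e s x) /\
  (forall s x, 0 <= s <= T -> A <= x <= f A ->
     Rabs (e s x - c * (folded_density (h s x) * dh s x)) <=
     eta * (c * (folded_density (h s x) * dh s x))).
Proof.
intros Heta.
assert (HB := B_gt).
assert (HfA : a < f A < b) by (apply component_stable; lra).
(* With [rho = / (1 + d)], [/ rho ^ 2 - 1 = 2 d + d^2 <= 3 d <= eta / 2]. *)
set (d := Rmin 1 (eta / 6)).
assert (Hd : 0 < d <= 1 /\ d <= eta / 6).
{ unfold d; split; [split|]; [apply Rmin_glb_lt; lra|apply Rmin_l|apply Rmin_r]. }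
set (rho := / (1 + d)).
assert (Hrho : 0 < rho < 1).
{ unfold rho; split; [apply Rinv_0_lt_compat; lra|].
  rewrite <- Rinv_1. apply Rinv_lt_contravar; lra. }
assert (Hrho2 : / rho ^ 2 - 1 <= eta / 2).
{ unfold rho. rewrite pow_inv, Rinv_inv. simpl. nra. }
destruct (two_sided_growth rho Hrho) as [C [HC [HC1 HC2]]].
destruct (continuity_ab_min folded_density A (f A)) as [y0 [Hy0 Hy0J]];
  [lra|intros; apply folded_density_cont|].
assert (Hk0 := folded_density_pos y0 Hy0J).
destruct (jcont_bounded_below dh T Hdhc) as [m1 [Hm1 Hdh]];
  [intros s x; apply (Hh s)|].
set (m0 := folded_density y0 * m1).
assert (Hm0 : 0 < m0) by (now apply Rmult_lt_0_compat).
assert (Hkap : forall s x, 0 <= s <= T -> A <= x <= f A ->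
  m0 <= folded_density (h s x) * dh s x).
{ intros s x Hs Hx. apply Rmult_le_compat; try lra.
  - apply Hy0. now apply h_segment.
  - apply Hdh; lra. }
(* A lower bound for [bump_height n / (B - A)] valid for all [n >= 2], so that the threshold for the
   end densities is fixed before [n]. *)
set (b0 := (b - a) / 3 / (B - A)).
assert (Hb0 : 0 < b0) by (unfold b0; apply Rdiv_lt_0_compat; lra).
destruct (orbit_sum_end_density_small rho (eta * (b0 * m0)) Hrho)
  as [n0 [Hn0 Hsmall]].
{ apply Rmult_lt_0_compat; [lra|now apply Rmult_lt_0_compat]. }
set (n := max n0 2). assert (Hn2 : (2 <= n)%nat) by lia.
assert (Hpj := concentrated_deriv_jcont n).
assert (Hpp : forall s x, 0 < concentrated_deriv n s x) by
  (intros; now apply concentrated_deriv_pos).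
destruct (jcont_bounded _ T Hpj) as [M0 HM0].
destruct (jcont_bounded_below _ T Hpj Hpp) as [p0 [Hp0 Hp0']].
(* Compactness gives bounds over [[0, 1]]; elsewhere the density is 1. *)
set (m := Rmin p0 1). set (M := Rmax M0 1).
assert (Hm : 0 < m) by (apply Rmin_glb_lt; lra).
assert (HM : 1 <= M) by apply Rmax_r.
assert (HmM : forall s x, 0 <= s <= T -> m <= concentrated_deriv n s x <= M).
{ intros s x Hs. destruct (classic (0 < x < 1)) as [Hx|Hx].
  - split.
    + apply Rle_trans with (1 := Rmin_l _ _). apply Hp0'; lra.
    + apply Rle_trans with (2 := Rmax_l _ _). apply HM0; lra.
  - rewrite (proj2 (outside_component n s x ltac:(lia) ltac:(lra))).
    split; [apply Rmin_r|apply Rmax_r]. }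
assert (HCM : 0 < C * M) by (apply Rmult_lt_0_compat; lra).
assert (Hem : 0 < eta / 4 * m * rho ^ 2).
{ apply Rmult_lt_0_compat; [apply Rmult_lt_0_compat; lra|apply pow_lt; lra]. }
destruct (pow_lt_1_zero rho) with (y := eta / 4 * m * rho ^ 2 / (C * M))
  as [N HN]; [rewrite Rabs_right; lra|now apply Rdiv_lt_0_compat|].
specialize (HN N (Nat.le_refl _)).
rewrite Rabs_right in HN by (apply Rle_ge, pow_le; lra).
assert (HN' : C * M * rho ^ N <= eta / 4 * m * rho ^ 2).
{ apply Rle_trans with (C * M * (eta / 4 * m * rho ^ 2 / (C * M))).
  - apply Rmult_le_compat_l; lra.
  - right; field; lra. }
assert (HW := orbit_weight_pos rho Hrho N).
set (W := / (2 * orbit_weight rho N)) in *.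
assert (HW' : 0 < W) by (unfold W; apply Rinv_0_lt_compat; lra).
set (beta := bump_height n / (B - A)).
assert (Hbeta : b0 <= beta).
{ unfold b0, beta, Rdiv at 1 3. apply Rmult_le_compat_r.
  - left; apply Rinv_0_lt_compat; lra.
  - now apply bump_height_pos. }
set (S0 := fun s => orbit_sum f df fi dfi (concentrated_deriv n s) rho N).
exists (fun s => orbit_average f fi rho (concentrated n s) N),
  (fun s x => S0 s x * W), (beta * W).
split; [apply Rmult_lt_0_compat; lra|].
split; [|split; [|split; [|split]]].
- intros s. apply (orbit_average_diffeo f df fi dfi rho Hf Hfi Hrho).
  now apply concentrated_diffeo.
- intros s x Hx. apply orbit_average_fix; try assumption.
  apply concentrated_fix; [lia|assumption].
- apply jcont_mult; [|apply jcont_const].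
  now apply orbit_sum_jcont.
- intros s x Hs.
  replace (S0 s (f x) * W * df x - S0 s x * W) with
    ((S0 s (f x) * df x - S0 s x) * W) by ring.
  rewrite Rabs_mult, (Rabs_right W) by lra. rewrite <- Rmult_assoc.
  apply Rmult_le_compat_r; [lra|].
  apply (orbit_sum_almost_invariant f df fi dfi rho C) with (m := m) (M := M);
    try assumption; [apply Hpp|intros; now apply HmM].
- intros s x Hs Hx. specialize (Hkap s x Hs Hx).
  set (K := folded_density (h s x) * dh s x) in *.
  assert (HS : S0 s x = orbit_sum f df fi dfi (end_density n) rho N x + beta * K).
  { unfold S0, concentrated_deriv.
    rewrite (orbit_sum_plus f df fi dfi rho (end_density n)). f_equal.
    unfold K. rewrite <- (orbit_sum_bump rho N s x Hx).
    unfold orbit_sum. rewrite scal_sum. apply sum_eq. intros; unfold beta; ring. }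
  rewrite HS.
  assert (Hsm := Hsmall n N x ltac:(lia) Hx).
  assert (0 <= orbit_sum f df fi dfi (end_density n) rho N x).
  { apply cond_pos_sum. intros k. apply Rmult_le_pos;
      [apply pow_le, pow_le; lra|].
    apply Rplus_le_le_0_compat; apply Rmult_le_pos; left;
      try apply end_density_pos; now apply iter_deriv_pos. }
  set (O := orbit_sum f df fi dfi (end_density n) rho N x) in *.
  (* The averaged end densities are the whole error, and [O <= eta b0 m0 <= eta beta K]. *)
  replace ((O + beta * K) * W - beta * W * K) with (O * W) by ring.
  rewrite Rabs_right by (apply Rle_ge, Rmult_le_pos; lra).
  replace (eta * (beta * W * K)) with (eta * (beta * K) * W) by ring.
  apply Rmult_le_compat_r; [lra|].
  apply Rle_trans with (1 := Hsm). apply Rmult_le_compat_l; [lra|].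
  apply Rmult_le_compat; lra.
Qed.

End Bump.

(** * Gluing along the path *)

(* A partition of unity: [hat j] is supported in [[j - 1, j + 1]], except that
   [hat 0] is [1] on the negative half line. *)
Definition hat (j : nat) (s : R) : R :=
  match j with
  | O => clamp (INR 0 + 1 - s)
  | S i => clamp (INR (S i) + 1 - s) - clamp (INR i + 1 - s)
  end.

Lemma sum_hat n s : sum_f_R0 (fun j => hat j s) n = clamp (INR n + 1 - s).
Proof. induction n as [|n IH]; [reflexivity|rewrite tech5, IH; unfold hat; ring]. Qed.

Lemma sum_hat_1 n s : s <= INR n -> sum_f_R0 (fun j => hat j s) n = 1.
Proof. intros Hs. rewrite sum_hat. apply clamp_ge1; lra. Qed.

Lemma hat_nonneg j s : 0 <= hat j s.
Proof.
destruct j as [|j]; unfold hat; [apply clamp_I01|].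
assert (clamp (INR j + 1 - s) <= clamp (INR (S j) + 1 - s)).
{ apply clamp_mono. rewrite S_INR; lra. } lra.
Qed.


Lemma hat_after j s : s + 1 <= INR (S j) -> hat (S j) s = 0.
Proof.
intros Hs; unfold hat. rewrite 2!clamp_ge1; rewrite S_INR in *; lra.
Qed.

Lemma hat_before j s : INR j + 1 <= s -> hat j s = 0.
Proof.
intros Hs; destruct j as [|j]; unfold hat; rewrite ?S_INR in *;
  rewrite ?clamp_le0; lra.
Qed.

Lemma hat_cont j s : continuity_pt (hat j) s.
Proof.
assert (H : forall u, continuity_pt (fun s => clamp (u - s)) s).
{ intros u. apply (continuity_pt_comp (fun s => u - s) clamp);
    [|apply clamp_cont]. apply derivable_continuous_pt. reg. }
destruct j as [|j]; unfold hat; [apply H|].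
apply (continuity_pt_minus (fun s => clamp (INR (S j) + 1 - s))); apply H.
Qed.

(** Nothing is cut off: [up s] exceeds [s], and hats of larger index vanish at [s]. For negative [s]
    the sum is the single term with [hat 0 s = 1]. *)
Definition hat_sum (a : nat -> R) (s : R) : R :=
  sum_f_R0 (fun j => hat j s * a j) (Z.to_nat (up s)).

Lemma hat_sum_eq a s n : s <= INR n ->
  hat_sum a s = sum_f_R0 (fun j => hat j s * a j) n.
Proof.
assert (H : forall m k, s <= INR m ->
  sum_f_R0 (fun j => hat j s * a j) (m + k) = sum_f_R0 (fun j => hat j s * a j) m).
{ intros m k Hm. induction k as [|k IH]; [now rewrite Nat.add_0_r|].
  rewrite Nat.add_succ_r, tech5, IH, hat_after; [ring|].
  rewrite S_INR, plus_INR. generalize (pos_INR k); lra. }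
assert (Hup : s <= INR (Z.to_nat (up s))).
{ destruct (Rle_lt_dec 0 s) as [Hs|Hs].
  - rewrite INR_IZR_INZ, Z2Nat.id.
    + generalize (archimed s); lra.
    + apply le_IZR. generalize (archimed s); lra.
  - generalize (pos_INR (Z.to_nat (up s))); lra. }
intros Hn. unfold hat_sum.
destruct (Nat.le_ge_cases n (Z.to_nat (up s))) as [Hle|Hle].
- replace (Z.to_nat (up s)) with (n + (Z.to_nat (up s) - n))%nat by lia.
  now apply H.
- replace n with (Z.to_nat (up s) + (n - Z.to_nat (up s)))%nat by lia.
  symmetry; now apply H.
Qed.

Lemma INR_above s : exists n, s <= INR n.
Proof.
destruct (INR_archimed 1 s) as [n Hn]; [lra|]. exists n; lra.
Qed.

Lemma hat_sum_pos a s : (forall j, 0 < a j) -> 0 < hat_sum a s.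
Proof.
intros Ha. destruct (INR_above s) as [n Hn]. rewrite (hat_sum_eq a s n Hn).
apply (sum_mult_pos (fun j => hat j s)); [intros; apply hat_nonneg|exact Ha|].
rewrite sum_hat_1; lra.
Qed.

(** Relative bounds survive nonnegative combinations, and only the indices [j > s - 1] carry weight
    at [s]; late times therefore see late families only. *)
Lemma hat_sum_abs (u v : nat -> R) s eps :
  (forall j, s < INR j + 1 -> Rabs (u j) <= eps * v j) ->
  Rabs (hat_sum u s) <= eps * hat_sum v s.
Proof.
intros H. unfold hat_sum. generalize (Z.to_nat (up s)); intros n.
assert (Hj : forall j, Rabs (hat j s * u j) <= eps * (hat j s * v j)).
{ intros j. destruct (Req_dec (hat j s) 0) as [H0|H0].
  - rewrite H0, Rmult_0_l, Rabs_R0; lra.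
  - rewrite Rabs_mult, (Rabs_right (hat j s)) by apply Rle_ge, hat_nonneg.
    replace (eps * (hat j s * v j)) with (hat j s * (eps * v j)) by ring.
    apply Rmult_le_compat_l; [apply hat_nonneg|]. apply H.
    destruct (Rlt_le_dec s (INR j + 1)) as [|Hle]; [assumption|].
    elim H0. now apply hat_before. }
induction n as [|n IH]; [apply Hj|]. rewrite 2!tech5.
apply Rle_trans with (1 := Rabs_triang _ _). specialize (Hj (S n)). lra.
Qed.

Lemma hat_sum_minus u v s : hat_sum (fun j => u j - v j) s = hat_sum u s - hat_sum v s.
Proof.
unfold hat_sum. rewrite <- minus_sum. apply sum_eq. intros; ring.
Qed.

Lemma hat_sum_scal_r u k s : hat_sum (fun j => u j * k) s = hat_sum u s * k.
Proof.
unfold hat_sum. rewrite <- sum_same. apply sum_eq. intros; ring.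
Qed.

(** The number of terms jumps with [s], but a common number serves a whole neighbourhood. *)
Lemma hat_sum_jcont (e : nat -> R -> R -> R) :
  (forall j, jointly_continuous (e j)) ->
  jointly_continuous (fun s x => hat_sum (fun j => e j s x) s).
Proof.
intros He s x. destruct (INR_above (s + 1)) as [n Hn].
apply continuity_2d_pt_ext_loc with
  (fun s x => sum_f_R0 (fun j => hat j s * e j s x) n).
- exists (mkposreal 1 Rlt_0_1). intros u v Hu _. simpl in Hu.
  apply Rabs_def2 in Hu. symmetry. apply hat_sum_eq; lra.
- apply (jcont_sum (fun j s x => hat j s * e j s x)). intros j.
  apply jcont_mult; [apply jcont_fst, hat_cont|apply He].
Qed.

Lemma hat_sum_diffeo (E e : nat -> R -> R) s :
  (forall j, line_diffeo (E j) (e j)) ->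
  line_diffeo (fun x => hat_sum (fun j => E j x) s)
    (fun x => hat_sum (fun j => e j x) s).
Proof.
intros HE. destruct (INR_above s) as [n Hn].
assert (H := line_diffeo_convex (fun j => hat j s) E e n
  (fun j => hat_nonneg j s) (sum_hat_1 n s Hn) HE).
assert (E1 : forall a, hat_sum a s = sum_f_R0 (fun j => hat j s * a j) n) by
  (intros; now apply hat_sum_eq).
destruct H as (H1 & H2 & H3 & H4). split; [|split; [|split]].
- intros x. rewrite E1. eapply is_derive_ext; [|apply H1].
  intros t; symmetry; apply (E1 (fun j => E j t)).
- intros x. eapply continuity_pt_ext; [|apply H2].
  intros t; symmetry; apply (E1 (fun j => e j t)).
- intros x. rewrite E1. apply H3.
- intros x Hx. rewrite 2!E1. now apply H4.
Qed.

Lemma hat_sum_const c s : hat_sum (fun _ => c) s = c.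
Proof.
destruct (INR_above s) as [n Hn]. rewrite (hat_sum_eq _ s n Hn), sum_same.
rewrite sum_hat_1 by assumption; ring.
Qed.

Lemma conjugating_family (f df : R -> R) (A : R) (h dh : R -> R -> R) :
  line_diffeo f df -> (forall x, f x = x -> df x = 1) -> A < f A ->
  (forall s, line_diffeo (h s) (dh s)) ->
  (forall s x, x <= A \/ f A <= x -> h s x = x /\ dh s x = 1) ->
  jointly_continuous h -> jointly_continuous dh ->
  exists H e : R -> R -> R,
    (forall s, line_diffeo (H s) (e s)) /\
    (forall s x, f x = x -> H s x = x) /\ jointly_continuous e /\
    (forall eps, 0 < eps -> exists S0, forall s x, S0 <= s ->
       Rabs (e s (f x) * df x - e s x) <= eps * e s x) /\
    (forall eps, 0 < eps -> exists S0, forall s, S0 <= s ->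
       exists c, 0 < c /\ forall x, A <= x <= f A ->
       Rabs (e s x - c * (folded_density f df A (h s x) * dh s x)) <=
       eps * (c * (folded_density f df A (h s x) * dh s x))).
Proof.
intros Hf Hfix HA Hh Hsupp Hhc Hdhc.
destruct (line_diffeo_inv f df Hf) as (fi & dfi & Hfi & Hffi & Hfif).
destruct (fixed_point_free_component f df A Hf ltac:(lra))
  as (a & b & Ha & Hb & Hfa & Hfb & Hno).
(* [hat j] vanishes from time [j + 1] on, hence the range [T]; the errors [/ (j + 1)] tend to 0
   along the indices that survive at late times. *)
assert (Hj : forall j : nat, exists Ee : (R -> R -> R) * (R -> R -> R) * R,
  let '(E, e, c) := Ee in let T := INR j + 1 in let eta := / (INR j + 1) in
  0 < c /\ (forall s, line_diffeo (E s) (e s)) /\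
  (forall s x, f x = x -> E s x = x) /\ jointly_continuous e /\
  (forall s x, 0 <= s <= T -> Rabs (e s (f x) * df x - e s x) <= eta * e s x) /\
  (forall s x, 0 <= s <= T -> A <= x <= f A ->
     Rabs (e s x - c * (folded_density f df A (h s x) * dh s x)) <=
     eta * (c * (folded_density f df A (h s x) * dh s x)))).
{ intros j. assert (0 < / (INR j + 1)) by
    (apply Rinv_0_lt_compat; generalize (pos_INR j); lra).
  destruct (good_family f df fi dfi A a b h dh Hf Hfi Hfif Hffi HA Ha Hb Hfa Hfb
    Hno Hh Hsupp Hhc Hdhc Hfix (INR j + 1) _ H) as (E & e & c & HE).
  now exists (E, e, c). }
destruct (functional_choice _ Hj) as [F HF].
set (E := fun j => fst (fst (F j))). set (e := fun j => snd (fst (F j))).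
set (c := fun j => snd (F j)).
assert (HF' : forall j, let T := INR j + 1 in let eta := / (INR j + 1) in
  0 < c j /\ (forall s, line_diffeo (E j s) (e j s)) /\
  (forall s x, f x = x -> E j s x = x) /\ jointly_continuous (e j) /\
  (forall s x, 0 <= s <= T ->
     Rabs (e j s (f x) * df x - e j s x) <= eta * e j s x) /\
  (forall s x, 0 <= s <= T -> A <= x <= f A ->
     Rabs (e j s x - c j * (folded_density f df A (h s x) * dh s x)) <=
     eta * (c j * (folded_density f df A (h s x) * dh s x)))).
{ intros j. specialize (HF j). unfold E, e, c.
  destruct (F j) as [[E' e'] c']. exact HF. }
clear HF. clearbody E e c.
assert (Heta : forall eps j s, 0 < eps -> 1 + / eps <= s -> s < INR j + 1 ->
  0 <= s <= INR j + 1 /\ / (INR j + 1) <= eps).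
{ intros eps j s Heps Hs Hsj.
  assert (0 < / eps) by (now apply Rinv_0_lt_compat).
  split; [lra|]. rewrite <- (Rinv_inv eps).
  apply Rinv_le_contravar; lra. }
exists (fun s x => hat_sum (fun j => E j s x) s),
  (fun s x => hat_sum (fun j => e j s x) s).
split; [|split; [|split; [|split]]].
- intros s. apply (hat_sum_diffeo (fun j => E j s) (fun j => e j s)).
  intros j; apply HF'.
- intros s x Hx. transitivity (hat_sum (fun _ => x) s); [|apply hat_sum_const].
  unfold hat_sum. apply sum_eq. intros j _. f_equal. now apply HF'.
- apply (hat_sum_jcont e). intros j; apply HF'.
- intros eps Heps. exists (1 + / eps). intros s x Hs.
  rewrite <- hat_sum_scal_r, <- hat_sum_minus. apply hat_sum_abs.
  intros j Hsj. destruct (Heta eps j s Heps Hs Hsj) as [Hs0 He].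
  destruct (HF' j) as (_ & H1 & _ & _ & H2 & _).
  apply Rle_trans with (1 := H2 s x Hs0).
  apply Rmult_le_compat_r; [left; apply (H1 s)|exact He].
- intros eps Heps. exists (1 + / eps). intros s Hs.
  (* The constants are averaged with the same weights, the condition being linear in the pair of [e]
     and [c]. *)
  exists (hat_sum c s). split; [apply hat_sum_pos; intros; apply HF'|].
  intros x Hx.
  rewrite <- hat_sum_scal_r, <- hat_sum_minus. apply hat_sum_abs.
  intros j Hsj. destruct (Heta eps j s Heps Hs Hsj) as [Hs0 He].
  destruct (HF' j) as (Hc & _ & _ & _ & _ & H2).
  apply Rle_trans with (1 := H2 s x Hs0 Hx).
  apply Rmult_le_compat_r; [|exact He].
  apply Rmult_le_pos; [lra|]. apply Rmult_le_pos; [|left; apply (Hh s)].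
  left. apply (folded_density_pos f df A); try assumption.
  now apply (h_segment f A h dh).
Qed.

(** * Diffeomorphisms of the interval and of the line *)

Lemma is_derive_is_deriv01 F dF f : (forall x, is_derive F x (dF x)) ->
  (forall x, I01 x -> f x = F x) -> is_deriv01 f dF.
Proof.
intros HF He x Hx eps Heps.
destruct (proj1 (is_derive_Reals F x (dF x)) (HF x) eps Heps) as [d Hd].
exists d; split; [apply cond_pos|]. intros y Hy Hne Hlt.
rewrite !He by assumption. specialize (Hd (y - x)).
replace (x + (y - x)) with y in Hd by ring. apply Hd; [lra|exact Hlt].
Qed.

Lemma is_deriv01_unique f d d' x : is_deriv01 f d -> is_deriv01 f d' ->
  I01 x -> d x = d' x.
Proof.
intros Hd Hd' Hx. destruct (Req_dec (d x) (d' x)) as [|Hne]; [assumption|].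
assert (Hp : 0 < Rabs (d x - d' x) / 2) by
  (apply Rdiv_lt_0_compat; [apply Rabs_pos_lt; lra|lra]).
destruct (Hd x Hx _ Hp) as [e1 [He1 H1]].
destruct (Hd' x Hx _ Hp) as [e2 [He2 H2]].
(* The cap [1 / 2] guarantees room inside [[0, 1]] on at least one side of [x]. *)
set (e := Rmin (1 / 2) (Rmin e1 e2)).
assert (He : 0 < e) by (repeat apply Rmin_glb_lt; lra).
assert (E0 : e <= 1 / 2) by apply Rmin_l.
assert (E12 : e <= Rmin e1 e2) by apply Rmin_r.
assert (E1 := Rle_trans _ _ _ E12 (Rmin_l _ _)).
assert (E2 := Rle_trans _ _ _ E12 (Rmin_r _ _)).
assert (Hy : exists y, I01 y /\ y <> x /\ Rabs (y - x) < e).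
{ unfold I01 in *. destruct (Rle_lt_dec x (1 / 2)).
  - exists (x + e / 2). repeat split; try lra. apply Rabs_def1; lra.
  - exists (x - e / 2). repeat split; try lra. apply Rabs_def1; lra. }
destruct Hy as [y [Hy [Hyx Hlt]]].
assert (A1 := H1 y Hy Hyx ltac:(lra)). assert (A2 := H2 y Hy Hyx ltac:(lra)).
set (q := (f y - f x) / (y - x)) in *.
assert (Rabs (d x - d' x) < Rabs (d x - d' x)); [|lra].
replace (d x - d' x) with ((q - d' x) - (q - d x)) at 1 by ring.
eapply Rle_lt_trans; [apply Rabs_triang|]. rewrite Rabs_Ropp; lra.
Qed.

(** [v0] is the identity when a map is extended and the constant 1 when a derivative is. *)
Definition extend (v0 : R -> R) (f : R -> R) (x : R) : R :=
  if Rle_dec 0 x then if Rle_dec x 1 then f x else v0 x else v0 x.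

Lemma extend_in v0 f x : I01 x -> extend v0 f x = f x.
Proof.
intros [H0 H1]. unfold extend.
destruct (Rle_dec 0 x), (Rle_dec x 1); lra.
Qed.

Lemma extend_out v0 f x : ~ I01 x -> extend v0 f x = v0 x.
Proof.
unfold I01, extend. intros H. destruct (Rle_dec 0 x), (Rle_dec x 1); tauto.
Qed.

Lemma extend_diffeo f d : Diff1p f -> is_deriv01 f d -> d 0 = 1 -> d 1 = 1 ->
  exists dF, line_diffeo (extend (fun x => x) f) dF /\ is_deriv01 f dF.
Proof.
intros [Hm [Hf0 [Hf1 [Hinc [d' [Hd' [Hc Hp]]]]]]] Hd Hd0 Hd1.
assert (I0 : I01 0) by (unfold I01; lra). assert (I1 : I01 1) by (unfold I01; lra).
rewrite (is_deriv01_unique f d d' 0 Hd Hd' I0) in Hd0.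
rewrite (is_deriv01_unique f d d' 1 Hd Hd' I1) in Hd1. clear d Hd.
set (F := extend (fun x => x) f). set (dF := extend (fun _ => 1) d').
assert (HF1 : forall x, ~ (0 < x < 1) -> F x = x /\ dF x = 1).
{ intros x Hx. destruct (classic (I01 x)) as [Hi|Hi].
  - assert (x = 0 \/ x = 1) as [-> | ->] by (unfold I01 in Hi; lra);
      unfold F, dF; rewrite !extend_in by assumption; tauto.
  - unfold F, dF; rewrite !extend_out by assumption; tauto. }
(* An interior point stays away from the complement of [[0,1]]; at the other
   points both functions take the values of the extension. *)
assert (Hnear : forall x, exists e, 0 < e /\ forall y, Rabs (y - x) < e ->
  (I01 x /\ I01 y) \/ (~ (0 < x < 1) /\ ~ (0 < y < 1))).
{ intros x. destruct (classic (0 < x < 1)) as [Hx|Hx].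
  - exists (Rmin x (1 - x)). split; [apply Rmin_glb_lt; lra|].
    intros y Hy. left.
    assert (A1 := Rlt_le_trans _ _ _ Hy (Rmin_l _ _)).
    assert (A2 := Rlt_le_trans _ _ _ Hy (Rmin_r _ _)).
    apply Rabs_def2 in A1, A2. unfold I01; lra.
  - destruct (classic (I01 x)) as [Hi|Hi].
    + exists 1. split; [lra|]. intros y _.
      destruct (classic (I01 y)); [tauto|right; unfold I01 in *; lra].
    + unfold I01 in Hi. destruct (Rlt_le_dec x 0).
      * exists (- x). split; [lra|]. intros y Hy. apply Rabs_def2 in Hy. right; lra.
      * exists (x - 1). split; [lra|]. intros y Hy. apply Rabs_def2 in Hy.
        right; lra. }
exists dF. split.
2:{ intros x Hx. unfold dF. rewrite extend_in by assumption. now apply Hd'. }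
split; [|split; [|split; [|exact HF1]]].
- intros x. apply is_derive_Reals. intros eps Heps.
  destruct (Hnear x) as [e [He Hn]].
  assert (Hq : exists e', 0 < e' /\ forall y, I01 x -> I01 y -> y <> x ->
    Rabs (y - x) < e' -> Rabs ((F y - F x) / (y - x) - dF x) < eps).
  { destruct (classic (I01 x)) as [Hx|Hx]; [|exists 1; split; [lra|tauto]].
    destruct (Hd' x Hx eps Heps) as [e' [He' H']].
    exists e'; split; [exact He'|]. intros y _ Hy Hyx Hlt.
    unfold F, dF. rewrite !extend_in by assumption. now apply H'. }
  destruct Hq as [e' [He' H']].
  assert (Hee : 0 < Rmin e e') by (now apply Rmin_glb_lt).
  exists (mkposreal _ Hee). simpl. intros z Hz Hlt.
  assert (A1 := Rlt_le_trans _ _ _ Hlt (Rmin_l _ _)).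
  assert (A2 := Rlt_le_trans _ _ _ Hlt (Rmin_r _ _)).
  assert (Hyx : x + z - x = z) by ring.
  specialize (Hn (x + z)). rewrite Hyx in Hn.
  destruct (Hn A1) as [[Hx Hy]|[Hx Hy]].
  + specialize (H' (x + z) Hx Hy). rewrite Hyx in H'. apply H'; [lra|exact A2].
  + rewrite (proj1 (HF1 _ Hy)), (proj1 (HF1 _ Hx)), (proj2 (HF1 _ Hx)).
    replace ((x + z - x) / z - 1) with 0 by (field; exact Hz).
    rewrite Rabs_R0; exact Heps.
- intros x eps Heps. destruct (Hnear x) as [e [He Hn]].
  assert (Hq : exists e', 0 < e' /\ forall y, I01 x -> I01 y ->
    Rabs (y - x) < e' -> Rabs (dF y - dF x) < eps).
  { destruct (classic (I01 x)) as [Hx|Hx]; [|exists 1; split; [lra|tauto]].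
    destruct (Hc x Hx eps Heps) as [e' [He' H']].
    exists e'; split; [exact He'|]. intros y _ Hy Hlt.
    unfold dF. rewrite !extend_in by assumption. now apply H'. }
  destruct Hq as [e' [He' H']].
  exists (Rmin e e'); split; [now apply Rmin_glb_lt|].
  simpl. unfold Rdist. intros y [_ Hlt].
  assert (A1 := Rlt_le_trans _ _ _ Hlt (Rmin_l _ _)).
  assert (A2 := Rlt_le_trans _ _ _ Hlt (Rmin_r _ _)).
  destruct (Hn y A1) as [[Hx Hy]|[Hx Hy]]; [now apply H'|].
  rewrite (proj2 (HF1 _ Hy)), (proj2 (HF1 _ Hx)).
  unfold Rminus; rewrite Rplus_opp_r, Rabs_R0; exact Heps.
- intros x. destruct (classic (I01 x)) as [Hx|Hx]; unfold dF.
  + rewrite extend_in by assumption. now apply Hp.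
  + rewrite extend_out by assumption. lra.
Qed.

Lemma supported_in_fix g S x : supported_in g S -> I01 x -> ~ S x -> g x = x.
Proof.
intros Hs Hx Hn. destruct (Req_dec (g x) x) as [|Hne]; [assumption|].
elim Hn. apply Hs. split; [exact Hx|]. intros eps Heps. exists x.
split; [exact Hx|split; [|exact Hne]].
unfold Rminus; rewrite Rplus_opp_r, Rabs_R0; exact Heps.
Qed.

Lemma continuity_pt_eq_left u v A : continuity_pt u A -> continuity_pt v A ->
  (forall x, x < A -> u x = v x) -> u A = v A.
Proof.
intros Hu Hv He. destruct (Req_dec (u A) (v A)) as [|Hne]; [assumption|].
assert (Hp : 0 < Rabs (u A - v A) / 2) by
  (apply Rdiv_lt_0_compat; [apply Rabs_pos_lt; lra|lra]).
destruct (Hu _ Hp) as [e1 [He1 H1]]. destruct (Hv _ Hp) as [e2 [He2 H2]].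
set (e := Rmin e1 e2). assert (0 < e) by (now apply Rmin_glb_lt).
assert (E1 : e <= e1) by apply Rmin_l. assert (E2 : e <= e2) by apply Rmin_r.
specialize (H1 (A - e / 2)). specialize (H2 (A - e / 2)).
simpl in H1, H2. unfold Rdist in *.
assert (Hc : Rabs (A - e / 2 - A) < e) by (apply Rabs_def1; lra).
assert (A1 := H1 ltac:(split; [split; [exact I|lra]|lra])).
assert (A2 := H2 ltac:(split; [split; [exact I|lra]|lra])).
rewrite He in A1 by lra.
assert (Rabs (u A - v A) < Rabs (u A - v A)); [|lra].
replace (u A - v A) with ((v (A - e / 2) - v A) - (v (A - e / 2) - u A)) at 1
  by ring.
eapply Rle_lt_trans; [apply Rabs_triang|]. rewrite Rabs_Ropp; lra.
Qed.

Lemma continuity_pt_eq_right u v A : continuity_pt u A -> continuity_pt v A ->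
  (forall x, A < x -> u x = v x) -> u A = v A.
Proof.
intros Hu Hv He.
assert (Hc : forall w, continuity_pt w A -> continuity_pt (fun x => w (- x)) (- A)).
{ intros w Hw. apply (continuity_pt_comp (fun x => - x) w).
  - apply derivable_continuous_pt. reg.
  - now rewrite Ropp_involutive. }
assert (H := continuity_pt_eq_left (fun x => u (- x)) (fun x => v (- x)) (- A)
  (Hc u Hu) (Hc v Hv)). simpl in H. rewrite Ropp_involutive in H.
apply H. intros x Hx. apply He; lra.
Qed.

(** Off the closed interval the derivative is computed locally; the two end points follow by
    continuity of [F] and [dF]. *)
Lemma line_diffeo_id_closed F dF A A' : line_diffeo F dF ->
  (forall x, x < A \/ A' < x -> F x = x) ->
  forall x, x <= A \/ A' <= x -> F x = x /\ dF x = 1.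
Proof.
intros HF He.
assert (Hd : forall x, x < A \/ A' < x -> dF x = 1).
{ intros x Hx. rewrite <- (is_derive_unique (fun x => x) x 1 (is_derive_id x)).
  symmetry. apply is_derive_unique. apply is_derive_ext_loc with F; [|apply HF].
  destruct Hx as [Hx|Hx].
  - assert (Hp : 0 < A - x) by lra. exists (mkposreal _ Hp). intros y Hy.
    apply Rabs_def2 in Hy. simpl in Hy. unfold minus, plus, opp in Hy; simpl in Hy.
    apply He; lra.
  - assert (Hp : 0 < x - A') by lra. exists (mkposreal _ Hp). intros y Hy.
    apply Rabs_def2 in Hy. simpl in Hy. unfold minus, plus, opp in Hy; simpl in Hy.
    apply He; lra. }
assert (Hci : forall x, continuity_pt (fun x => x) x) by
  (intros; apply derivable_continuous_pt, derivable_pt_id).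
assert (Hc1 : forall x, continuity_pt (fun _ => 1) x) by
  (intros; apply continuity_pt_const; intros u v; reflexivity).
assert (HcF : forall x, continuity_pt F x) by
  (intros; eapply line_diffeo_cont; eauto).
assert (Hcd : forall x, continuity_pt dF x) by apply HF.
intros x [[Hx| ->]|[Hx| <-]].
- split; [apply He|apply Hd]; tauto.
- split.
  + apply (continuity_pt_eq_left F (fun x => x)); auto.
  + apply (continuity_pt_eq_left dF (fun _ => 1)); auto.
- split; [apply He|apply Hd]; tauto.
- split.
  + apply (continuity_pt_eq_right F (fun x => x)); auto.
  + apply (continuity_pt_eq_right dF (fun _ => 1)); auto.
Qed.

Lemma extend_supported_diffeo g A A' : 0 < A -> A <= A' -> A' < 1 ->
  Diff1p g -> supported_in g (fun x => A <= x <= A') ->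
  exists dg, line_diffeo (extend (fun x => x) g) dg /\ is_deriv01 g dg /\
    forall x, x <= A \/ A' <= x -> extend (fun x => x) g x = x /\ dg x = 1.
Proof.
intros HA HAA HA' Hg Hs.
assert (Hid : forall x, I01 x -> x < A \/ A' < x -> g x = x).
{ intros x Hx Hc. apply (supported_in_fix g _ x Hs Hx). lra. }
pose proof Hg as [_ [Hg0 [Hg1 [_ [d [Hd _]]]]]].
(* Fixed points accumulate at [z], and along them the difference quotient is 1. *)
assert (Hend : forall z, I01 z -> g z = z -> (forall e, 0 < e -> exists y,
  I01 y /\ y <> z /\ Rabs (y - z) < e /\ g y = y) -> d z = 1).
{ intros z Hz Hgz Hy. destruct (Req_dec (d z) 1) as [|Hne]; [assumption|].
  assert (Hp : 0 < Rabs (1 - d z)) by (apply Rabs_pos_lt; lra).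
  destruct (Hd z Hz _ Hp) as [e [He H]].
  destruct (Hy e He) as [y [Iy [Hyz [Hlt Hgy]]]].
  specialize (H y Iy Hyz Hlt). rewrite Hgy, Hgz in H.
  replace ((y - z) / (y - z)) with 1 in H by (field; lra). lra. }
assert (Hd0 : d 0 = 1).
{ apply Hend; [unfold I01; lra|exact Hg0|]. intros e He.
  assert (0 < Rmin e A) by (now apply Rmin_glb_lt).
  assert (Rmin e A <= e) by apply Rmin_l. assert (Rmin e A <= A) by apply Rmin_r.
  exists (Rmin e A / 2). assert (I01 (Rmin e A / 2)) by (unfold I01; lra).
  repeat split; try (unfold I01 in *; lra); [apply Rabs_def1; lra|].
  apply Hid; [assumption|lra]. }
assert (Hd1 : d 1 = 1).
{ apply Hend; [unfold I01; lra|exact Hg1|]. intros e He.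
  assert (0 < Rmin e (1 - A')) by (apply Rmin_glb_lt; lra).
  assert (Rmin e (1 - A') <= e) by apply Rmin_l.
  assert (Rmin e (1 - A') <= 1 - A') by apply Rmin_r.
  exists (1 - Rmin e (1 - A') / 2).
  assert (I01 (1 - Rmin e (1 - A') / 2)) by (unfold I01; lra).
  repeat split; try (unfold I01 in *; lra); [apply Rabs_def1; lra|].
  apply Hid; [assumption|lra]. }
destruct (extend_diffeo g d Hg Hd Hd0 Hd1) as [dg [H1 H2]].
exists dg; split; [exact H1|split; [exact H2|]].
apply (line_diffeo_id_closed _ _ A A' H1).
intros x Hx. destruct (classic (I01 x)) as [Hi|Hi].
- rewrite extend_in by assumption. now apply Hid.
- now rewrite extend_out.
Qed.

Lemma line_diffeo_Diff1p F dF : line_diffeo F dF -> Diff1p F.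
Proof.
intros HF. split; [|split; [|split; [|split]]].
- intros x Hx. now apply (line_diffeo_I01 F dF).
- now apply (line_diffeo_0 F dF).
- now apply (line_diffeo_1 F dF).
- intros x y _ _ H. now apply (line_diffeo_incr F dF).
- exists dF. split; [|split].
  + apply (is_derive_is_deriv01 F dF F); [apply HF|reflexivity].
  + intros x _ eps Heps. destruct HF as (_ & Hc & _).
    destruct (Hc x eps Heps) as [e [He H]]. exists e; split; [exact He|].
    intros y _ Hy. destruct (Req_dec y x) as [->|Hne].
    * unfold Rminus; rewrite Rplus_opp_r, Rabs_R0; exact Heps.
    * apply (H y). split; [split; [exact I|congruence]|exact Hy].
  + intros x _; apply HF.
Qed.

(** Both maps fix 0, so the mean value theorem on [[0, x]], of length at most 1, suffices. Uniform
    closeness thus always comes from closeness of derivatives. *)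
Lemma line_diffeo_C1_C0 F dF G dG eps x : line_diffeo F dF -> line_diffeo G dG ->
  (forall x, I01 x -> Rabs (dF x - dG x) <= eps) -> I01 x ->
  Rabs (F x - G x) <= eps.
Proof.
intros HF HG Hd [Hx0 Hx1].
destruct (MVT_gen (fun y => F y - G y) 0 x (fun y => dF y - dG y)) as [c [Hc He]].
- intros y _. apply (is_derive_minus F G y); [apply HF|apply HG].
- intros y _. apply continuity_pt_minus; eapply line_diffeo_cont; eauto.
- rewrite Rmin_left, Rmax_right in Hc by lra.
  rewrite (line_diffeo_0 F dF HF), (line_diffeo_0 G dG HG), !Rminus_0_r in He.
  rewrite He, Rabs_mult, (Rabs_right x) by lra.
  assert (H := Hd c ltac:(unfold I01; lra)).
  generalize (Rabs_pos (dF c - dG c)). nra.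
Qed.

(** * Asymptotic invariance of a family of densities *)

Definition asymptotically_invariant (e : R -> R -> R) (g dg : R -> R) : Prop :=
  forall eps, 0 < eps -> exists S0, forall s x, S0 <= s ->
    Rabs (e s (g x) * dg x - e s x) <= eps * e s x.

Lemma asymptotically_invariant_comp e a da b db :
  (forall s x, 0 < e s x) -> line_diffeo b db ->
  asymptotically_invariant e a da -> asymptotically_invariant e b db ->
  asymptotically_invariant e (fun x => a (b x)) (fun x => da (b x) * db x).
Proof.
intros He Hb Ha Hbi eps Heps.
(* Two relative errors [d <= 1] compound to at most [(1 + d)^2 - 1 <= 3 d]. *)
set (d := Rmin 1 (eps / 3)).
assert (Hd0 : 0 < d) by (apply Rmin_glb_lt; lra).
assert (Hd1 : d <= 1) by apply Rmin_l.
assert (Hd2 : d <= eps / 3) by apply Rmin_r.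
destruct (Ha d Hd0) as [S1 H1]. destruct (Hbi d Hd0) as [S2 H2].
exists (Rmax S1 S2). intros s x Hs.
assert (Q1 := H1 s (b x) (Rle_trans _ _ _ (Rmax_l _ _) Hs)).
assert (Q2 := H2 s x (Rle_trans _ _ _ (Rmax_r _ _) Hs)).
assert (Hdb : 0 < db x) by apply Hb. assert (Hex := He s x).
set (u := e s (a (b x)) * da (b x)) in *. set (v := e s (b x)) in *.
set (w := e s x) in *.
replace (e s (a (b x)) * (da (b x) * db x)) with (u * db x) by (unfold u; ring).
apply Rabs_le_between in Q1. apply Rabs_le_between in Q2. apply Rabs_le.
assert ((u - v) * db x <= d * v * db x) by (apply Rmult_le_compat_r; lra).
assert (- (d * v) * db x <= (u - v) * db x) by (apply Rmult_le_compat_r; lra).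
assert (v * db x <= 2 * w) by nra.
assert (d * (v * db x) <= d * (2 * w)) by (apply Rmult_le_compat_l; lra).
assert (3 * d * w <= eps * w) by (apply Rmult_le_compat_r; lra).
lra.
Qed.

Lemma asymptotically_invariant_inv e g dg gi dgi :
  (forall s x, 0 < e s x) -> line_diffeo g dg -> line_diffeo gi dgi ->
  (forall x, g (gi x) = x) ->
  asymptotically_invariant e g dg -> asymptotically_invariant e gi dgi.
Proof.
intros He Hg Hgi Hggi Hinv eps Heps.
(* The error comes out relative to the pulled-back density, which for [d <= 1 / 2] is at most twice
   the original one. *)
set (d := Rmin (1 / 2) (eps / 2)).
assert (Hd0 : 0 < d) by (apply Rmin_glb_lt; lra).
assert (Hd1 : d <= 1 / 2) by apply Rmin_l.
assert (Hd2 : d <= eps / 2) by apply Rmin_r.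
destruct (Hinv d Hd0) as [S1 H1]. exists S1. intros s y Hs.
specialize (H1 s (gi y) Hs). rewrite Hggi in H1.
assert (Hdgi : 0 < dgi y) by apply Hgi. assert (Hey := He s y).
assert (Hprod : dg (gi y) * dgi y = 1) by (now apply (dfi_df gi dgi g dg)).
set (w := e s (gi y)) in *. set (v := e s y) in *.
apply Rabs_le_between in H1. apply Rabs_le.
assert (A1 : (v * dg (gi y) - w) * dgi y <= d * w * dgi y) by
  (apply Rmult_le_compat_r; lra).
assert (A2 : - (d * w) * dgi y <= (v * dg (gi y) - w) * dgi y) by
  (apply Rmult_le_compat_r; lra).
replace ((v * dg (gi y) - w) * dgi y) with (v * (dg (gi y) * dgi y) - w * dgi y)
  in A1, A2 by ring.
rewrite Hprod in A1, A2. set (z := w * dgi y) in *.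
replace (d * w * dgi y) with (d * z) in A1 by (unfold z; ring).
replace (- (d * w) * dgi y) with (- (d * z)) in A2 by (unfold z; ring).
assert (Hw := He s (gi y)). assert (0 < z) by (now apply Rmult_lt_0_compat).
assert (z <= 2 * v) by nra.
assert (d * z <= d * (2 * v)) by (apply Rmult_le_compat_l; lra).
assert (d * (2 * v) <= eps * v) by nra. lra.
Qed.

(* On [[A, A']] the density is nearly a multiple of the pullback by [h s] of
   the fixed density [kap], which conjugates close to the identity hardly move. *)
Lemma asymptotically_invariant_supported (e h dh : R -> R -> R)
  (kap g dg : R -> R) (A A' : R) :
  A <= A' -> (forall s x, 0 < e s x) ->
  line_diffeo g dg -> (forall x, x <= A \/ A' <= x -> g x = x /\ dg x = 1) ->
  (forall s, line_diffeo (h s) (dh s)) ->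
  (forall s x, A <= x <= A' -> A <= h s x <= A') ->
  (forall y, continuity_pt kap y) -> (forall y, A <= y <= A' -> 0 < kap y) ->
  (forall eps, 0 < eps -> exists S0, forall s, S0 <= s ->
     exists c, 0 < c /\ forall x, A <= x <= A' ->
     Rabs (e s x - c * (kap (h s x) * dh s x)) <=
       eps * (c * (kap (h s x) * dh s x))) ->
  (forall eps, 0 < eps -> exists S0, forall s x, S0 <= s -> A <= x <= A' ->
     Rabs (h s (g x) - h s x) < eps /\
     Rabs (dh s (g x) * dg x - dh s x) <= eps * dh s x) ->
  asymptotically_invariant e g dg.
Proof.
intros HAA He Hg Hid Hh HhJ Hkc Hkp Hnear Hconj eps Heps.
(* With [K] and [K2] the model densities before and after pulling back by [g], the errors are [d K]
   for [e], [3 d K] between the models and [d K2 <= 5 / 2 d K] for the pullback of [e]: less than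
   [7 d K] in all, and [K] is at most twice [e]. *)
set (d := Rmin (1 / 2) (eps / 14)).
assert (Hd0 : 0 < d) by (apply Rmin_glb_lt; lra).
assert (Hd1 : d <= 1 / 2) by apply Rmin_l.
assert (Hd2 : d <= eps / 14) by apply Rmin_r.
assert (HgJ : forall x, A <= x <= A' -> A <= g x <= A').
{ intros x Hx.
  assert (L1 := line_diffeo_le g dg A x Hg (proj1 Hx)).
  assert (L2 := line_diffeo_le g dg x A' Hg (proj2 Hx)).
  rewrite (proj1 (Hid A (or_introl (Rle_refl _)))) in L1.
  rewrite (proj1 (Hid A' (or_intror (Rle_refl _)))) in L2. now split. }
destruct (continuity_ab_min kap A A') as [y0 [Hmin Hy0]]; [lra|auto|].
assert (Hk0 := Hkp y0 Hy0).
assert (Hdk : 0 < d * kap y0) by (now apply Rmult_lt_0_compat).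
(* Measuring the oscillation of [kap] against its minimum makes it a relative error [d]. *)
destruct (@Heine_cor2 kap A A' (fun x _ => Hkc x) (mkposreal _ Hdk))
  as [del Hdel]; simpl in Hdel.
destruct (Hnear d Hd0) as [S1 H1].
destruct (Hconj (Rmin d del)) as [S2 H2];
  [apply Rmin_glb_lt; [exact Hd0|apply cond_pos]|].
exists (Rmax S1 S2). intros s x Hs.
assert (Hex := He s x).
destruct (classic (A <= x <= A')) as [Hx|Hx].
2:{ destruct (Hid x) as [-> ->]; [lra|].
  rewrite Rmult_1_r. unfold Rminus; rewrite Rplus_opp_r, Rabs_R0.
  apply Rmult_le_pos; lra. }
destruct (H1 s (Rle_trans _ _ _ (Rmax_l _ _) Hs)) as [c [Hc Hcx]].
destruct (H2 s x (Rle_trans _ _ _ (Rmax_r _ _) Hs) Hx) as [C0 C1].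
assert (Q1 := Hcx x Hx). assert (Q2 := Hcx (g x) (HgJ x Hx)).
assert (Hdh : 0 < dh s x) by apply (Hh s).
assert (Hdg : 0 < dg x) by apply Hg.
assert (Hdhg : 0 < dh s (g x)) by apply (Hh s).
assert (C1' : Rabs (dh s (g x) * dg x - dh s x) <= d * dh s x).
{ apply Rle_trans with (1 := C1). apply Rmult_le_compat_r; [lra|apply Rmin_l]. }
assert (Q3 := Hdel (h s (g x)) (h s x) (HhJ s _ (HgJ x Hx)) (HhJ s _ Hx)
  (Rlt_le_trans _ _ _ C0 (Rmin_r _ _))).
assert (Hkx := Hmin (h s x) (HhJ s x Hx)).
assert (Hkg := Hmin (h s (g x)) (HhJ s _ (HgJ x Hx))).
set (k1 := kap (h s x)) in *. set (k2 := kap (h s (g x))) in *.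
set (p1 := dh s x) in *. set (p2 := dh s (g x) * dg x) in *.
set (e1 := e s x) in *. set (e2 := e s (g x)) in *.
assert (Q2' : Rabs (e2 * dg x - c * (k2 * p2)) <= d * (c * (k2 * p2))).
{ replace (e2 * dg x - c * (k2 * p2)) with
    ((e2 - c * (k2 * dh s (g x))) * dg x) by (unfold p2; ring).
  replace (d * (c * (k2 * p2))) with (d * (c * (k2 * dh s (g x))) * dg x)
    by (unfold p2; ring).
  rewrite Rabs_mult, (Rabs_right (dg x)) by lra.
  apply Rmult_le_compat_r; lra. }
assert (Hp2 : 0 < p2) by (now apply Rmult_lt_0_compat).
assert (Hk1 : 0 < k1) by lra. assert (Hk2 : 0 < k2) by lra.
assert (D1 : Rabs (k2 * p2 - k1 * p1) <= 3 * d * (k1 * p1)).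
{ replace (k2 * p2 - k1 * p1) with ((k2 - k1) * p2 + k1 * (p2 - p1)) by ring.
  eapply Rle_trans; [apply Rabs_triang|]. rewrite 2!Rabs_mult.
  rewrite (Rabs_right p2), (Rabs_right k1) by lra.
  assert (Hp21 : p2 <= 2 * p1).
  { apply Rabs_le_between in C1'. nra. }
  assert (Rabs (k2 - k1) * p2 <= d * k1 * (2 * p1)).
  { apply Rmult_le_compat; [apply Rabs_pos|lra| |exact Hp21].
    apply Rle_trans with (d * kap y0); [lra|apply Rmult_le_compat_l; lra]. }
  assert (k1 * Rabs (p2 - p1) <= k1 * (d * p1)) by
    (apply Rmult_le_compat_l; lra). lra. }
set (K := c * (k1 * p1)) in *.
assert (HK : 0 < K) by (repeat apply Rmult_lt_0_compat; assumption).
set (K2 := c * (k2 * p2)) in *.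
assert (D2 : Rabs (K2 - K) <= 3 * d * K).
{ unfold K2, K. rewrite <- Rmult_minus_distr_l, Rabs_mult, (Rabs_right c) by lra.
  replace (3 * d * (c * (k1 * p1))) with (c * (3 * d * (k1 * p1))) by ring.
  apply Rmult_le_compat_l; lra. }
apply Rabs_le_between in Q1, Q2', D2. apply Rabs_le.
assert (K2 <= 5 / 2 * K) by nra.
assert (d * K2 <= d * (5 / 2 * K)) by (apply Rmult_le_compat_l; lra).
assert (K <= 2 * e1) by nra.
assert (7 * (d * K) <= eps * e1).
{ assert (d * K <= eps / 14 * (2 * e1)); [|lra].
  apply Rmult_le_compat; lra. }
assert (0 <= d * K) by (apply Rmult_le_pos; lra).
lra.
Qed.

(** * Paths over the half-open interval *)

(* A right inverse is [t |-> / (1 - t)]. *)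
Definition path_time (s : R) : R := 1 - / Rmax 1 s.

Lemma path_time_range s : 0 <= path_time s < 1.
Proof.
unfold path_time. assert (1 <= Rmax 1 s) by apply Rmax_l.
assert (0 < / Rmax 1 s) by (apply Rinv_0_lt_compat; lra).
assert (/ Rmax 1 s <= 1) by
  (rewrite <- Rinv_1 at 2; apply Rinv_le_contravar; lra).
lra.
Qed.

Lemma path_time_near_1 d s : 0 < d -> / d < s -> 1 - d < path_time s < 1.
Proof.
intros Hd Hs. split; [|apply path_time_range].
assert (0 < / d) by (now apply Rinv_0_lt_compat).
assert (s <= Rmax 1 s) by apply Rmax_r.
assert (/ Rmax 1 s < d); [|unfold path_time; lra].
rewrite <- (Rinv_inv d). apply Rinv_lt_contravar; [apply Rmult_lt_0_compat; lra|lra].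
Qed.

Lemma path_time_cont s : continuity_pt path_time s.
Proof.
apply (continuity_pt_minus (fun _ => 1) (fun s => / Rmax 1 s)).
- apply continuity_pt_const; intros u v; reflexivity.
- apply continuity_pt_inv.
  + intros eps Heps. exists eps; split; [exact Heps|]. intros y [_ Hy].
    simpl in *. unfold Rdist in *. eapply Rle_lt_trans; [|exact Hy].
    unfold Rmax, Rabs. destruct (Rle_dec 1 y), (Rle_dec 1 s);
    repeat (match goal with |- context [Rcase_abs ?u] => destruct (Rcase_abs u) end);
    lra.
  + assert (1 <= Rmax 1 s) by apply Rmax_l. lra.
Qed.

Lemma jcont_of_uniform a :
  (forall s0 eps, 0 < eps -> exists d, 0 < d /\ forall s, Rabs (s - s0) < d ->
     forall x, Rabs (a s x - a s0 x) < eps) ->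
  (forall s x, continuity_pt (a s) x) -> jointly_continuous a.
Proof.
intros Hu Hc s x eps.
assert (He : 0 < eps / 2) by (generalize (cond_pos eps); lra).
destruct (Hu s _ He) as [d1 [Hd1 H1]].
destruct (Hc s x _ He) as [d2 [Hd2 H2]].
assert (Hd : 0 < Rmin d1 d2) by (now apply Rmin_glb_lt).
exists (mkposreal _ Hd). simpl. intros u v Hu' Hv'.
assert (A1 := H1 u (Rlt_le_trans _ _ _ Hu' (Rmin_l _ _)) v).
assert (A2 : Rabs (a s v - a s x) < eps / 2).
{ destruct (Req_dec v x) as [->|Hne].
  - unfold Rminus; rewrite Rplus_opp_r, Rabs_R0; exact He.
  - apply (H2 v). split; [split; [exact I|congruence]|].
    exact (Rlt_le_trans _ _ _ Hv' (Rmin_r _ _)). }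
replace (a u v - a s x) with ((a u v - a s v) + (a s v - a s x)) by ring.
eapply Rle_lt_trans; [apply Rabs_triang|]. lra.
Qed.

(** [C1_path] compares two times uniformly in [x] over [[0, 1]], and elsewhere all the maps agree;
    continuity in [x] at each time then gives joint continuity. *)
Lemma extended_path (h hinv : R -> R -> R) A A' : 0 < A -> A <= A' -> A' < 1 ->
  (forall t, 0 <= t < 1 -> Diff1p (h t) /\ is_inv01 (h t) (hinv t) /\
     supported_in (h t) (fun x => A <= x <= A')) ->
  C1_path h ->
  let hh := fun s => extend (fun x => x) (h (path_time s)) in
  exists dh : R -> R -> R,
    (forall s, line_diffeo (hh s) (dh s)) /\
    (forall s x, x <= A \/ A' <= x -> hh s x = x /\ dh s x = 1) /\
    jointly_continuous hh /\ jointly_continuous dh.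
Proof.
intros HA HAA HA' Hh Hpath hh.
assert (Hex : forall s, exists dg, line_diffeo (hh s) dg /\
  is_deriv01 (h (path_time s)) dg /\
  forall x, x <= A \/ A' <= x -> hh s x = x /\ dg x = 1).
{ intros s. destruct (Hh _ (path_time_range s)) as [H1 [_ H2]].
  now apply (extend_supported_diffeo _ A A'). }
destruct (functional_choice _ Hex) as [dh Hdh].
assert (Hpc : forall s0 eps, 0 < eps -> exists d, 0 < d /\ forall s,
  Rabs (s - s0) < d -> forall x, Rabs (hh s x - hh s0 x) < eps /\
    Rabs (dh s x - dh s0 x) < eps).
{ intros s0 eps Heps.
  destruct (Hpath _ (path_time_range s0) eps Heps) as [d1 [Hd1 H1]].
  destruct (path_time_cont s0 d1 Hd1) as [d [Hd H2]].
  exists d; split; [exact Hd|]. intros s Hs x.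
  assert (Ht : Rabs (path_time s - path_time s0) < d1).
  { destruct (Req_dec s s0) as [->|Hne].
    - unfold Rminus; rewrite Rplus_opp_r, Rabs_R0; exact Hd1.
    - apply (H2 s). split; [split; [exact I|congruence]|exact Hs]. }
  destruct (classic (I01 x)) as [Hx|Hx].
  - destruct (H1 _ (path_time_range s) Ht x Hx) as [E1 E2].
    unfold hh. rewrite 2!extend_in by assumption. split; [exact E1|].
    apply E2; apply Hdh.
  - assert (Ho : x <= A \/ A' <= x) by (unfold I01 in Hx; lra).
    destruct (proj2 (proj2 (Hdh s)) x Ho) as [-> ->].
    destruct (proj2 (proj2 (Hdh s0)) x Ho) as [-> ->].
    unfold Rminus; rewrite 2!Rplus_opp_r, Rabs_R0; tauto. }
exists dh. split; [|split; [|split]].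
- intros s; apply Hdh.
- intros s; apply Hdh.
- apply jcont_of_uniform.
  + intros s0 eps Heps. destruct (Hpc s0 eps Heps) as [d [Hd H]].
    exists d; split; [exact Hd|]. intros s Hs x. now apply H.
  + intros s x. apply line_diffeo_cont with (dh s). apply Hdh.
- apply jcont_of_uniform.
  + intros s0 eps Heps. destruct (Hpc s0 eps Heps) as [d [Hd H]].
    exists d; split; [exact Hd|]. intros s Hs x. now apply H.
  + intros s x. apply (Hdh s).
Qed.

(** * From invariant densities to conjugates close to the identity *)

(** Reading the derivative of the conjugate at [F x] avoids the inverse and matches the form of the
    invariance estimates. *)
Lemma line_diffeo_conj F dF g dg Fi dFi : line_diffeo F dF -> line_diffeo g dg ->
  line_diffeo Fi dFi -> (forall x, Fi (F x) = x) ->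
  exists dk, line_diffeo (fun y => F (g (Fi y))) dk /\
    forall x, dk (F x) * dF x = dF (g x) * dg x.
Proof.
intros HF Hg HFi HFiF.
exists (fun y => dF (g (Fi y)) * (dg (Fi y) * dFi y)). split.
- apply (line_diffeo_comp F dF (fun y => g (Fi y)) (fun y => dg (Fi y) * dFi y));
    [exact HF|]. now apply line_diffeo_comp.
- intros x. rewrite HFiF.
  assert (H := dfi_df F dF Fi dFi HF HFi HFiF x).
  transitivity (dF (g x) * dg x * (dFi (F x) * dF x)); [ring|rewrite H; ring].
Qed.

Lemma conj_to_id_density (h hinv : R -> R -> R) (g dg : R -> R) (dh : R -> R -> R) :
  (forall t, 0 <= t < 1 -> is_inv01 (h t) (hinv t)) ->
  C1_to_id_at1 (fun t x => h t (g (hinv t x))) ->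
  let ext := extend (fun x => x) in
  line_diffeo (ext g) dg ->
  (forall s, line_diffeo (ext (h (path_time s))) (dh s)) ->
  forall eps, 0 < eps -> exists S0, forall s x, S0 <= s -> I01 x ->
    Rabs (ext (h (path_time s)) (ext g x) - ext (h (path_time s)) x) < eps /\
    Rabs (dh s (ext g x) * dg x - dh s x) <= eps * dh s x.
Proof.
intros Hinv Hconj ext Hg Hh eps Heps.
destruct (Hconj eps Heps) as [d [Hd H]].
exists (/ d + 1). intros s x Hs Hx.
assert (Ht := path_time_near_1 d s Hd ltac:(lra)).
set (t := path_time s) in *.
assert (Hhs : line_diffeo (ext (h t)) (dh s)) by apply Hh.
destruct (line_diffeo_inv _ _ Hhs) as (hi & dhi & Hhi & Hhhi & Hhih).
destruct (line_diffeo_conj _ _ _ _ _ _ Hhs Hg Hhi Hhih) as [dk [Hk Hdk]].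
assert (Hy : I01 (ext (h t) x)) by (now apply (line_diffeo_I01 _ (dh s))).
(* [hinv t] is constrained on [[0, 1]] only; there it must agree with the inverse [hi] of the
   extension. *)
assert (Heq : forall y, I01 y -> h t (g (hinv t y)) = ext (h t) (ext g (hi y))).
{ intros y Iy. destruct (Hinv t) with (x := y) as [H1 [H2 _]];
    [apply path_time_range|exact Iy|].
  assert (E : hi y = hinv t y).
  { rewrite <- H2 at 1. rewrite <- (extend_in (fun x => x) (h t)) by exact H1.
    apply Hhih. }
  rewrite E. assert (Ig := line_diffeo_I01 _ _ _ Hg H1).
  unfold ext in *. rewrite (extend_in _ g) in * by exact H1.
  now rewrite extend_in. }
destruct (H t Ht _ Hy) as [E1 E2].
rewrite Heq in E1 by exact Hy. rewrite Hhih in E1. split; [exact E1|].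
specialize (E2 dk (is_derive_is_deriv01 _ _ _ (proj1 Hk) Heq)).
rewrite <- Hdk. assert (0 < dh s x) by apply Hhs.
replace (dk (ext (h t) x) * dh s x - dh s x) with
  ((dk (ext (h t) x) - 1) * dh s x) by ring.
rewrite Rabs_mult, (Rabs_right (dh s x)) by lra.
apply Rmult_le_compat_r; lra.
Qed.

(** Elements of the generated group, inverses in particular, are pinned down on [[0, 1]] only, so
    each is traded for a diffeomorphism of the line that agrees with it there. *)
Lemma asymptotically_invariant_gen (e : R -> R -> R) f G
  (good := fun a => exists F dF, line_diffeo F dF /\
    (forall x, I01 x -> a x = F x) /\ asymptotically_invariant e F dF) :
  (forall s x, 0 < e s x) -> good f -> (forall g, G g -> good g) ->
  forall a, gen_group f G a -> good a.
Proof.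
intros He Hf HG a Ha. induction Ha as [|g Hg|a b _ IHa _ IHb|a b _ IHa Hab].
- exact Hf.
- now apply HG.
- destruct IHa as (F & dF & HF & HaF & HFe).
  destruct IHb as (K & dK & HK & HbK & HKe).
  exists (fun x => F (K x)), (fun x => dF (K x) * dK x).
  split; [now apply line_diffeo_comp|split].
  + intros x Hx. rewrite HbK by exact Hx. apply HaF.
    now apply (line_diffeo_I01 K dK).
  + now apply asymptotically_invariant_comp.
- destruct IHa as (F & dF & HF & HaF & HFe).
  destruct (line_diffeo_inv F dF HF) as (K & dK & HK & HFK & HKF).
  exists K, dK. split; [exact HK|split].
  + intros x Hx. destruct (Hab x Hx) as [H1 [H2 _]].
    rewrite <- H2 at 2. rewrite HaF by exact H1. now rewrite HKF.
  + now apply (asymptotically_invariant_inv e F dF).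
Qed.

Lemma invariant_family_conclusion f (Gen : (R -> R) -> Prop) (H e : R -> R -> R) :
  (forall s, line_diffeo (H s) (e s)) ->
  (forall s x, I01 x -> f x = x -> H s x = x) -> jointly_continuous e ->
  (forall g, Gen g -> exists F dF, line_diffeo F dF /\
    (forall x, I01 x -> g x = F x) /\ asymptotically_invariant e F dF) ->
  (exists H Hinv : R -> R -> R,
     (forall t, 0 <= t < 1 ->
        Diff1p (H t) /\ is_inv01 (H t) (Hinv t) /\
        supported_in (H t) (support f) /\
        (forall d, is_deriv01 (H t) d -> d 0 = 1 /\ d 1 = 1)) /\
     C1_path H /\
     forall g, Gen g -> C1_to_id_at1 (fun t x => H t (g (Hinv t x))))
  /\ C1_close_to_id Gen.
Proof.
intros HH Hfix He Hgen.
assert (Hinv : forall s, exists K, exists dK, line_diffeo K dK /\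
  (forall x, H s (K x) = x) /\ (forall x, K (H s x) = x)).
{ intros s. destruct (line_diffeo_inv _ _ (HH s)) as (K & dK & HK).
  now exists K, dK. }
destruct (functional_choice _ Hinv) as [K HK].
assert (Hepos : forall s x, 0 < e s x) by (intros s; apply (HH s)).
assert (Hder : forall s, is_deriv01 (H s) (e s)).
{ intros s. apply (is_derive_is_deriv01 (H s)); [apply (HH s)|reflexivity]. }
assert (I0 : I01 0) by (unfold I01; lra). assert (I1 : I01 1) by (unfold I01; lra).
assert (HD : forall s, Diff1p (H s)) by
  (intros s; apply (line_diffeo_Diff1p _ (e s)), HH).
assert (HI : forall s, is_inv01 (H s) (K s)).
{ intros s x Hx. destruct (HK s) as (dK & HKd & HK1 & HK2).
  split; [now apply (line_diffeo_I01 _ dK)|split; [apply HK1|apply HK2]]. }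
set (sg := fun t => / (1 - t)).
assert (Hconv : forall g, Gen g ->
  C1_to_id_at1 (fun t x => H (sg t) (g (K (sg t) x)))).
{ intros g Hg eps Heps. destruct (Hgen g Hg) as (F & dF & HF & HgF & HFe).
  (* Half of [eps]: the estimates are non-strict, the conclusion is strict. *)
  assert (Heps2 : 0 < eps / 2) by lra.
  destruct (HFe _ Heps2) as [S0 HS].
  assert (HM : 1 <= Rmax 1 S0) by apply Rmax_l.
  exists (/ Rmax 1 S0). split; [apply Rinv_0_lt_compat; lra|].
  intros t Ht x Hx.
  assert (Hs : S0 <= sg t).
  { apply Rle_trans with (1 := Rmax_r 1 S0). unfold sg.
    rewrite <- (Rinv_inv (Rmax 1 S0)). apply Rinv_le_contravar; lra. }
  set (s := sg t) in *.
  destruct (HK s) as (dK & HKd & HK1 & HK2).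
  destruct (line_diffeo_conj _ _ _ _ _ _ (HH s) HF HKd HK2) as [dk [Hk Hdk]].
  assert (Heq : forall y, I01 y -> H s (g (K s y)) = H s (F (K s y))).
  { intros y Hy. rewrite HgF; [reflexivity|]. now apply (line_diffeo_I01 _ dK). }
  assert (Hdk1 : forall y, I01 y -> Rabs (dk y - 1) <= eps / 2).
  { intros y _. rewrite <- (HK1 y). set (u := K s y).
    assert (Hu := HS s u Hs). rewrite <- Hdk in Hu.
    assert (Heu := Hepos s u).
    replace (dk (H s u) * e s u - e s u) with ((dk (H s u) - 1) * e s u) in Hu
      by ring.
    rewrite Rabs_mult, (Rabs_right (e s u)) in Hu by lra.
    now apply Rmult_le_reg_r in Hu. }
  split.
  - rewrite Heq by exact Hx.
    assert (Rabs (H s (F (K s x)) - x) <= eps / 2); [|lra].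
    apply (line_diffeo_C1_C0 (fun y => H s (F (K s y))) dk
      (fun x => x) (fun _ => 1)); try assumption. apply line_diffeo_id.
  - intros d Hd.
    rewrite (is_deriv01_unique _ d dk x Hd
      (is_derive_is_deriv01 _ _ _ (proj1 Hk) Heq) Hx).
    specialize (Hdk1 x Hx). lra. }
split.
- exists (fun t => H (sg t)), (fun t => K (sg t)). split; [|split; [|exact Hconv]].
  + intros t Ht. split; [apply HD|split; [apply HI|split]].
    (* [H] fixes the fixed points of [f], so whatever it moves is moved by [f], and closures
       follow. *)
    * intros x [Hx Hs]. split; [exact Hx|]. intros eps Heps.
      destruct (Hs eps Heps) as [y [Hy [Hlt Hne]]]. exists y.
      split; [exact Hy|split; [exact Hlt|]]. intros Hfy. now apply Hne, Hfix.
    * intros d Hd. rewrite (is_deriv01_unique _ _ _ 0 Hd (Hder _) I0).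
      rewrite (is_deriv01_unique _ _ _ 1 Hd (Hder _) I1).
      destruct (HH (sg t)) as (_ & _ & _ & Ho). split; apply Ho; lra.
  + intros t0 Ht0 eps Heps.
    assert (Heps2 : 0 < eps / 2) by lra.
    destruct (uniform_continuity_2d_1d' e 0 1 (sg t0) (fun x _ => He _ x)
      (mkposreal _ Heps2)) as [d Hd]; simpl in Hd.
    assert (Hsc : continuity_pt sg t0).
    { unfold sg. apply (continuity_pt_inv (fun t => 1 - t)); [|lra].
      apply derivable_continuous_pt. reg. }
    destruct (Hsc d (cond_pos d)) as [d' [Hd' H']].
    exists d'; split; [exact Hd'|]. intros t Ht Hlt x Hx.
    assert (Hst : Rabs (sg t - sg t0) < d).
    { destruct (Req_dec t t0) as [->|Hne].
      - unfold Rminus; rewrite Rplus_opp_r, Rabs_R0; apply cond_pos.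
      - apply (H' t). split; [split; [exact I|congruence]|exact Hlt]. }
    assert (Hee : forall x, I01 x -> Rabs (e (sg t) x - e (sg t0) x) <= eps / 2).
    { intros y Hy. left. apply Rabs_def2 in Hst.
      assert (Hd0 := cond_pos d).
      apply Hd; try (unfold I01 in Hy; lra).
      unfold Rminus; rewrite Rplus_opp_r, Rabs_R0; exact Hd0. }
    split.
    * assert (Rabs (H (sg t) x - H (sg t0) x) <= eps / 2); [|lra].
      now apply (line_diffeo_C1_C0 _ (e (sg t)) _ (e (sg t0))).
    * intros dd dd0 E1 E2.
      rewrite (is_deriv01_unique _ _ _ x E1 (Hder _) Hx).
      rewrite (is_deriv01_unique _ _ _ x E2 (Hder _) Hx).
      specialize (Hee x Hx). lra.
- set (tn := fun n : nat => 1 - / (INR n + 1)).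
  exists (fun n => H (sg (tn n))), (fun n => K (sg (tn n))).
  split; [intros n; split; [apply HD|apply HI]|].
  intros g Hg eps Heps. destruct (Hconv g Hg eps Heps) as [d [Hd H']].
  destruct (INR_archimed d 1 Hd) as [N HN].
  exists N. intros n Hn x Hx. apply H'; [|exact Hx].
  assert (INR N <= INR n) by (now apply le_INR).
  assert (Hp : 0 < INR n + 1) by (generalize (pos_INR n); lra).
  assert (0 < / (INR n + 1)) by (now apply Rinv_0_lt_compat).
  assert (/ (INR n + 1) < d); [|unfold tn; lra].
  apply Rmult_lt_reg_r with (INR n + 1); [exact Hp|].
  rewrite Rinv_l by lra. nra.
Qed.

(** Stated for a map that moves points of the domain to the right. This loses nothing, as a map and
    its inverse have the same fixed points and the same fundamental domain, read from opposite
    ends. *)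
Lemma fundamental_domain_family (F dF : R -> R) (A : R) (G : (R -> R) -> Prop)
  (h hinv : R -> R -> R) :
  line_diffeo F dF -> (forall x, F x = x -> dF x = 1) -> A < F A ->
  is_group G ->
  (forall g, G g -> supported_in g (fun x => A <= x <= F A)) ->
  (forall t, 0 <= t < 1 ->
     Diff1p (h t) /\ is_inv01 (h t) (hinv t) /\
     supported_in (h t) (fun x => A <= x <= F A)) ->
  C1_path h ->
  (forall g, G g -> C1_to_id_at1 (fun t x => h t (g (hinv t x)))) ->
  exists H e : R -> R -> R,
    (forall s, line_diffeo (H s) (e s)) /\
    (forall s x, F x = x -> H s x = x) /\ jointly_continuous e /\
    asymptotically_invariant e F dF /\
    forall g, G g -> exists g' dg, line_diffeo g' dg /\
      (forall x, I01 x -> g x = g' x) /\ asymptotically_invariant e g' dg.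
Proof.
intros HF Hfix HA HG HGs Hh Hpath Hconj.
assert (HA01 : 0 < A < 1).
{ destruct (classic (0 < A < 1)) as [|Hn]; [assumption|].
  rewrite (line_diffeo_out F dF A HF Hn) in HA; lra. }
assert (HFA : F A < 1).
{ rewrite <- (line_diffeo_1 F dF HF). apply (line_diffeo_incr F dF); tauto. }
destruct (extended_path h hinv A (F A) (proj1 HA01) (Rlt_le _ _ HA) HFA Hh Hpath)
  as [dh [Hhd [Hsupp [Hj1 Hj2]]]].
set (hh := fun s => extend (fun x => x) (h (path_time s))) in *.
destruct (conjugating_family F dF A hh dh HF Hfix HA Hhd Hsupp Hj1 Hj2)
  as (H & e & H1 & H2 & H3 & H4 & H5).
exists H, e. split; [exact H1|split; [exact H2|split; [exact H3|split; [exact H4|]]]].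
intros g Hg.
destruct (extend_supported_diffeo g A (F A) (proj1 HA01) (Rlt_le _ _ HA) HFA
  (proj1 HG g Hg) (HGs g Hg)) as [dg [Hgd [_ Hgid]]].
exists (extend (fun x => x) g), dg. split; [exact Hgd|split].
- intros x Hx. now rewrite extend_in.
- apply (asymptotically_invariant_supported e hh dh (folded_density F dF A) _ _
    A (F A)); try assumption.
  + lra.
  + intros s; apply (H1 s).
  + intros s x Hx. now apply (h_segment F A hh dh).
  + intros y. now apply folded_density_cont.
  + intros y Hy. now apply folded_density_pos.
  + intros eps Heps.
    destruct (conj_to_id_density h hinv g dg dh) with (eps := eps) as [S0 HS0];
      try assumption.
    * intros t Ht; now apply Hh.
    * now apply Hconj.
    * exists S0. intros s x Hs Hx. apply HS0; [exact Hs|unfold I01; lra].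
Qed.

Theorem theoremt (f : R -> R) (x0 : R) (G : (R -> R) -> Prop)
  (h hinv : R -> R -> R) :
  Diff1p f -> no_hyp_fixed f ->
  I01 x0 -> f x0 <> x0 ->
  is_group G ->
  (forall g, G g -> supported_in g (segment x0 (f x0))) ->
  (forall t, 0 <= t < 1 ->
     Diff1p (h t) /\ is_inv01 (h t) (hinv t) /\
     supported_in (h t) (segment x0 (f x0))) ->
  C1_path h ->
  (forall g, G g -> C1_to_id_at1 (fun t x => h t (g (hinv t x)))) ->
  (exists H Hinv : R -> R -> R,
     (forall t, 0 <= t < 1 ->
        Diff1p (H t) /\ is_inv01 (H t) (Hinv t) /\
        supported_in (H t) (support f) /\
        (forall d, is_deriv01 (H t) d -> d 0 = 1 /\ d 1 = 1)) /\
     C1_path H /\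
     forall g, gen_group f G g -> C1_to_id_at1 (fun t x => H t (g (Hinv t x))))
  /\ C1_close_to_id (gen_group f G).
Proof.
intros Hf Hnh Hx0 Hfx0 HG HGs Hh Hpath Hconj.
pose proof Hf as [_ [Hf0 [Hf1 [_ [d [Hd _]]]]]].
assert (I0 : I01 0) by (unfold I01; lra). assert (I1 : I01 1) by (unfold I01; lra).
(* The end points 0 and 1 are fixed, hence not hyperbolic, which is what the extension by the
   identity requires. *)
destruct (extend_diffeo f d Hf Hd (Hnh 0 I0 Hf0 d Hd) (Hnh 1 I1 Hf1 d Hd))
  as [dF [HF HdF]].
set (F := extend (fun x => x) f) in *.
assert (HfF : forall x, I01 x -> f x = F x).
{ intros x Hx. unfold F. now rewrite extend_in. }
assert (Hfix : forall x, F x = x -> dF x = 1).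
{ intros x Hx. destruct (classic (I01 x)) as [Hi|Hi].
  - apply (Hnh x Hi); [now rewrite HfF|exact HdF].
  - apply HF. unfold I01 in Hi. lra. }
destruct (line_diffeo_inv F dF HF) as (Fi & dFi & HFi & HFFi & HFiF).
assert (Hcore : exists H e : R -> R -> R,
    (forall s, line_diffeo (H s) (e s)) /\
    (forall s x, F x = x -> H s x = x) /\ jointly_continuous e /\
    asymptotically_invariant e F dF /\
    forall g, G g -> exists g' dg, line_diffeo g' dg /\
      (forall x, I01 x -> g x = g' x) /\ asymptotically_invariant e g' dg).
{ destruct (Rlt_le_dec x0 (f x0)) as [Hlt|Hle].
  - assert (HS : forall u, supported_in u (segment x0 (f x0)) ->
      supported_in u (fun x => x0 <= x <= F x0)).
    { intros u Hu x Hx. specialize (Hu x Hx). unfold segment in Hu.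
      rewrite Rmin_left, Rmax_right in Hu by lra. now rewrite <- HfF. }
    apply (fundamental_domain_family F dF x0 G h hinv); try assumption.
    + now rewrite <- HfF.
    + intros g Hg. apply HS. now apply HGs.
    + intros t Ht. destruct (Hh t Ht) as [E1 [E2 E3]].
      split; [exact E1|split; [exact E2|now apply HS]].
  - (* Here the inverse of [f] moves [f x0] to the right. *)
    assert (E0 : Fi (f x0) = x0) by (rewrite HfF by exact Hx0; apply HFiF).
    assert (HS : forall u, supported_in u (segment x0 (f x0)) ->
      supported_in u (fun x => f x0 <= x <= Fi (f x0))).
    { intros u Hu x Hx. specialize (Hu x Hx). unfold segment in Hu.
      rewrite Rmin_right, Rmax_left in Hu by lra. now rewrite E0. }
    assert (Hfi : forall x, Fi x = x -> F x = x).
    { intros x Hx. rewrite <- Hx at 1. apply HFFi. }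
    destruct (fundamental_domain_family Fi dFi (f x0) G h hinv)
      as (H & e & H1 & H2 & H3 & H4 & H5); try assumption.
    + intros x Hx. assert (E := dfi_df F dF Fi dFi HF HFi HFiF x).
      rewrite (Hfi x Hx), (Hfix x (Hfi x Hx)) in E. lra.
    + rewrite E0; lra.
    + intros g Hg. apply HS. now apply HGs.
    + intros t Ht. destruct (Hh t Ht) as [E1 [E2 E3]].
      split; [exact E1|split; [exact E2|now apply HS]].
    + exists H, e. split; [exact H1|split; [|split; [exact H3|split; [|exact H5]]]].
      * intros s x Hx. apply H2. rewrite <- Hx at 1. apply HFiF.
      * apply (asymptotically_invariant_inv e Fi dFi); try assumption.
        intros s; apply (H1 s). }
destruct Hcore as (H & e & H1 & H2 & H3 & H4 & H5).
apply (invariant_family_conclusion f _ H e); try assumption.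
- intros s x Hx Hfx. apply H2. now rewrite <- HfF.
- apply asymptotically_invariant_gen; [intros s; apply (H1 s)| |exact H5].
  exists F, dF. tauto.
Qed.
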